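(* Let $G$ be a finite group, $p$ an odd prime, and $N$ a normal subgroup of $G$ such that $G/N$ is $p$-nilpotent. Let $P$ be a Sylow $p$-subgroup of $N$ and assume that $N_G(P)$ is $p$-nilpotent. Suppose that there is an integer $m$ with $1<p^m<|P|$ such that every subgroup of $P$ of order $p^m$ that does not have a $p$-nilpotent supplement in $G$ is $\Pi$-normal in $G$. Then $G$ is $p$-nilpotent.
   Context: All groups are finite. For a finite group $X$, $\pi(X)$ denotes the set of primes dividing $|X|$; for a set $\pi$ of primes, an integer $n\ge 1$ is a $\pi$-number if all its prime divisors belong to $\pi$. A group is $p$-nilpotent if it has a normal Hall $p'$-subgroup (a normal $p$-complement). A supplement of a subgroup $H$ in $G$ is a subgroup $T\le G$ with $HT=G$; a $p$-nilpotent supplement is a supplement that is a $p$-nilpotent group. A subgroup $H$ of $G$ has $\Pi$-property in $G$ if for every chief factor $L/K$ of $G$ the index $|G/K : N_{G/K}(HK/K\cap L/K)|$ is a $\pi(HK/K\cap L/K)$-number. A subgroup $H$ of $G$ is $\Pi$-normal in $G$ if there are a subnormal subgroup $T$ of $G$ with $HT=G$ and a subgroup $I$ with $H\cap T\le I\le H$ such that $I$ has $\Pi$-property in $G$. *)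

(* Defs.v *)
From mathcomp Require Import all_boot all_fingroup all_solvable.

Set Implicit Arguments.
Unset Strict Implicit.
Unset Printing Implicit Defensive.

Local Open Scope group_scope.

Section Defs.

Variable gT : finGroupType.
Implicit Types (p : nat) (G H T I K L : {group gT}) (A : {set gT}).

Definition p_nilpotent p A : Prop :=
  exists K, K <| A /\ p^'.-Hall(A) K.

Definition supplement H G T : Prop := T \subset G /\ H * T = G.

Definition has_p_nilpotent_supplement p H G : Prop :=
  exists T, supplement H G T /\ p_nilpotent p T.

(* Intended for H \subset G. As K is normal in G, H lies in 'N(K), so that
   H / K is HK/K. *)
Definition Pi_property G H : Prop :=
  forall K L, chief_factor G K L ->
    \pi((H / K) :&: (L / K)).-nat
      #|G / K : 'N_(G / K)((H / K) :&: (L / K))|.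

Definition Pi_normal G H : Prop :=
  exists T I,
    [/\ T <|<| G, H * T = G, H :&: T \subset I, I \subset H & Pi_property G I].

End Defs.

(* Main.v *)
Require Import Defs.
From mathcomp Require Import all_boot all_fingroup all_solvable.
From mathcomp Require Import all_algebra all_character.

Set Implicit Arguments.
Unset Strict Implicit.
Unset Printing Implicit Defensive.

Local Open Scope group_scope.

(** Let P0 be a Sylow p-subgroup of G containing P, so that P = P0 :&: N, and
    let R be the subgroup generated by the p'-elements of G, the smallest
    normal subgroup whose quotient is a p-group. A subnormal supplement T of a
    p-subgroup H has p-power index, so it contains R. Thus, if H is Pi-normal,
    there is an I between H :&: R and H such that, in every chief factor L / K
    of G, the normaliser of the image of I :&: L has p-power index
    ([Pi_normal_embedded]). This weaker property, [p_embedded], passes to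
    quotients of G, and it is all that is used. Its force is
    [p_embedded_chief]: the normaliser of K <*> (I :&: L) together with P0
    generates G, so the normal closure of this subgroup, which is L as soon as
    I :&: L is not contained in K, is generated by its P0-conjugates.

    If G is not p-nilpotent, let Y be minimal among the subgroups containing P0
    that are not p-nilpotent. As the normaliser of P0 in Y is p-nilpotent,
    Thompson's normal p-complement theorem shows that Y / 'O_p(Y) is
    p-nilpotent ([min_nonpnil_quotient]). With O = 'O_p(Y) and K a Hall
    p'-subgroup of Y, this gives P0 = O * 'N_P0(K), where 'N_P0(K) is proper in
    P0. Fix a maximal subgroup Q0 of P0 containing 'N_P0(K). A p-nilpotent
    supplement T of a subgroup H of P meets Y in a subgroup normalising a Hall
    p'-subgroup of Y, whence P0 = H * 'N_P0(K) ([supplement_Hall_norm]).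
    Therefore no subgroup of P :&: Q0 has such a supplement, and all those of
    order p ^ m are embedded.

    If m = 1, take W minimal among the Y-normal subgroups of O not centralised
    by K. It has exponent p, so embedded subgroups of order p can be found in
    [~: W, P0]. A chief factor at the top of the normal closure of W in G is
    then covered by [~: W, P0], which contradicts the nilpotency of P0
    ([embedded_order_p]).

    If m > 1, induct on the order of G. Take a minimal normal subgroup M of G
    contained in R. If M is a p'-group, or if it is a p-group of order less
    than p ^ m, then G / M satisfies the hypotheses and is p-nilpotent. In the
    first case so is G; in the second one K centralises O / M, which forces
    P0 = M * 'N_P0(K), and this is impossible ([minimal_quotient_contra]). The
    embedding of the subgroups of P :&: Q0 shows that these are the only cases,
    except for #|M| = p ^ m, which is dealt with by comparing M with the other
    subgroups of P of order p ^ m that contain a given subgroup of index p of M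
    ([card_minimal_neq]).

    Thompson's theorem [Thompson_pnil] is deduced from that of Frobenius
    ([Frobenius_pnil]), itself a consequence of the transfer. A minimal
    counterexample is again a Y as above. Let V be the largest elementary
    abelian subgroup of the centre of O. Some abelian subgroup A of P of
    largest order is not contained in O, for otherwise the subgroup generated
    by all of them would be normal in Y. By replacement A can be chosen
    normalised by V, so that A acts quadratically on V; as p is odd, K can then
    only commute with A modulo the centraliser of V ([quadratic_cent]), and
    this puts A in O. *)

(** * Transfer and control of fusion *)

Section Fusion.

Import FiniteModule.

(** If P controls fusion then every factor of the transfer of x into the
    abelianisation of P is fused inside P, so the transfer maps x to the image
    of x ^+ #|G : P|. The index is prime to p, so the kernel of the transfer
    misses all the elements of P outside the derived subgroup. *)
Lemma control_fusion_quotient gT p (G P : {group gT}) :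
    prime p -> p.-Sylow(G) P -> P :!=: 1 ->
    (forall x g, x \in P -> g \in G -> x ^ g \in P ->
       exists2 u, u \in P & x ^ g = x ^ u) ->
  exists K : {group gT}, [/\ K <| G, K \proper G & p.-group (G / K)].
Proof.
move=> p_pr sylP ntP fusP; have [sPG pP p'PG] := and3P sylP.
have nP'P: P \subset 'N(P^`(1)) := der_norm 1 P.
pose al := [morphism of restrm nP'P (coset P^`(1))].
have abal: abelian (al @* P).
  by rewrite morphim_restrm setIid; apply: sub_der1_abelian.
pose V := transfer_morphism G abal.
have pV: p.-group (V @* G).
  apply: (@pnat_dvd _ #|[set: fmod_of abal]|); first by rewrite cardSg ?subsetT.
  have: p.-group (al @* P) by apply: morphim_pgroup.
  by rewrite cardsT /pgroup card_sub.
have [x Px P'x]: exists2 x, x \in P & x \notin P^`(1).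
  have: ~~ (P \subset P^`(1)).
    by have /andP[_] := sol_der1_proper (pgroup_sol pP) (subxx P) ntP.
  by case/subsetPn => x; exists x.
have Gx := subsetP sPG x Px.
have VE: V x = GRing.natmul (fmod abal (al x)) #|G : P|.
  have trX := transversalP (rcosets_cycle_partition sPG Gx).
  rewrite [V x](transfer_cycle_expansion sPG abal Gx trX).
  rewrite -(sum_index_rcosets_cycle sPG Gx trX) -GRing.sumrMnr.
  apply: eq_bigr => y Xy; set n := #|_ : _|.
  have Gy: y \in G by apply: (subsetP (transversal_sub trX)).
  have Pxn: (x ^+ n) ^ (y^-1) \in P.
    have := mulg_exp_card_rcosets P x y.
    by rewrite -/n mem_rcoset conjgE invgK mulgA.
  have [||u Pu ->] := fusP _ _ _ _ Pxn; rewrite ?groupX ?groupV //.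
  rewrite -[restrm _ _ _]/(fmod abal (al (x ^+ n ^ u))).
  rewrite -fmodX ?mem_morphim //; congr (fmod abal _).
  rewrite conjXg morphX ?groupJ //; congr (_ ^+ n).
  rewrite morphJ //; apply/conjg_fixP/commgP.
  by apply: (centsP abal); rewrite mem_morphim.
exists ('ker V)%G; split.
- exact: ker_normal.
- rewrite properE subsetIl; apply/subsetPn; exists x => //.
  apply: contra P'x => /mker /(congr1 val).
  rewrite VE fmvalZ fmodK ?mem_morphim // => /eqP.
  rewrite -order_dvdn => dvd_al; apply: coset_idr; first exact: (subsetP nP'P).
  apply/eqP; rewrite -order_eq1 -dvdn1; apply: etrans dvd_al.
  rewrite -[#|G : P|]mul1n Gauss_dvdl //.
  have pal: p.-elt (al x) by apply: morph_p_elt => //; apply: mem_p_elt Px.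
  exact: pnat_coprime pal p'PG.
- by rewrite /pgroup (card_isog (first_isog V)).
Qed.

End Fusion.

(** * p-nilpotent groups and coprime action *)

(** 'O_p^'(A) is the only possible normal p-complement of A, so p-nilpotency is
    decidable. *)
Definition pnil (gT : finGroupType) (p : nat) (A : {set gT}) := p^'.-Hall(A) 'O_p^'(A).

Section PNil.

Variables (gT : finGroupType) (p : nat).
Implicit Types G H K M P : {group gT}.

Lemma p_nilpotentP G : reflect (p_nilpotent p G) (pnil p G).
Proof.
apply: (iffP idP) => [nilG | [K [nsKG hallK]]].
  by exists 'O_p^'(G)%G; rewrite pcore_normal.
by rewrite /pnil (normal_Hall_pcore hallK).
Qed.

Lemma pnilE G K : K <| G -> p^'.-Hall(G) K -> pnil p G.
Proof. by move=> nsKG hallK; apply/p_nilpotentP; exists K. Qed.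

Lemma pnilS G H : H \subset G -> pnil p G -> pnil p H.
Proof.
move=> sHG nilG; apply: (@pnilE _ (H :&: 'O_p^'(G))%G).
  by rewrite (normalGI sHG) ?pcore_normal.
by rewrite /= setIC (setI_normal_Hall (pcore_normal _ _) nilG).
Qed.

Lemma pnilJ G x : pnil p (G :^ x) = pnil p G.
Proof. by rewrite /pnil pcoreJ pHallJ2. Qed.

Lemma p'group_pnil G : p^'.-group G -> pnil p G.
Proof. by move=> p'G; rewrite /pnil pcore_pgroup_id // pHallE subxx part_pnat_id /=. Qed.

Lemma pnil_mul G P : pnil p G -> p.-Sylow(G) P -> 'O_p^'(G) * P = G.
Proof.
move=> nilG sylP; apply: sdprodW; apply/(sdprod_Hall_pcoreP nilG).
by rewrite (eq_pHall _ _ (negnK _)).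
Qed.

(** Both subgroups are normal and their orders are coprime. This is how
    p-nilpotency of a local subgroup yields elements that centralise P. *)
Lemma norm_p'core_cent G P : P <| G -> p.-group P -> 'O_p^'(G) \subset 'C(P).
Proof.
case/andP=> sPG nPG pP; apply/commG1P/trivgP.
have <-: 'O_p^'(G) :&: P = 1.
  by apply: coprime_TIg; rewrite coprime_sym (pnat_coprime pP (pcore_pgroup _ _)).
rewrite subsetI commg_subl commg_subr (subset_trans (pcore_sub _ _) nPG).
by rewrite (subset_trans sPG) ?gFnorm.
Qed.

Lemma pnil_p'quotient G M :
  M <| G -> p^'.-group M -> pnil p (G / M) -> pnil p G.
Proof.
move=> nsMG p'M nilGM.
have [K defK sMK nsKG] := inv_quotientN nsMG (pcore_normal p^' (G / M)).
have nMK := subset_trans (normal_sub nsKG) (normal_norm nsMG).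
apply: (pnilE nsKG); rewrite /pHall normal_sub //=; apply/andP; split.
  have: p^'.-group (K / M) by rewrite -defK pcore_pgroup.
  by rewrite /pgroup card_quotient // -(Lagrange sMK) pnatM => ->; rewrite andbT.
have /and3P[_ _] := nilGM.
by rewrite defK /= index_quotient_eq ?(normal_norm nsMG) ?(normal_sub nsKG) ?subIset ?sMK ?orbT.
Qed.

End PNil.

Lemma pnil_quotient gT p (G M : {group gT}) :
  G \subset 'N(M) -> pnil p G -> pnil p (G / M).
Proof.
move=> nMG nilG.
apply: (@pnilE _ p (G / M)%G ('O_p^'(G) / M)%G); first by rewrite quotient_normal ?pcore_normal.
by rewrite quotient_pHall // (subset_trans (pcore_sub _ _)).
Qed.

Lemma p'group_sub_pquo (gT : finGroupType) (p : nat) (G C K : {group gT}) :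
  C <| G -> p.-group (G / C) -> K \subset G -> p^'.-group K -> K \subset C.
Proof.
case/andP=> _ nCG pGC sKG p'K; have nCK := subset_trans sKG nCG.
rewrite -quotient_sub1 //.
have <-: (G / C) :&: (K / C) = 1; last by rewrite subsetI quotientS /=.
by apply: coprime_TIg; apply: pnat_coprime pGC (quotient_pgroup _ p'K).
Qed.

Lemma coprime_comm_cent_prod (gT : finGroupType) (A G : {group gT}) :
    A \subset 'N(G) -> coprime #|G| #|A| -> solvable G ->
  [~: G, A] * 'C_G(A) = G.
Proof.
move=> nGA coGA solG; have sRG: [~: G, A] \subset G by rewrite commg_subl.
have nRG: G \subset 'N([~: G, A]) := commg_norml G A.
have nRA: A \subset 'N([~: G, A]) := commg_normr A G.
apply/eqP; rewrite eqEsubset mul_subG ?subsetIl //= -quotientSK //.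
by rewrite coprime_quotient_cent // subsetI subxx quotient_cents2r.
Qed.

(** G is [~: G, A] * 'C_G(A), and A centralises both factors. *)
Lemma coprime_comm_cent (gT : finGroupType) (A G : {group gT}) :
    A \subset 'N(G) -> coprime #|G| #|A| -> solvable G ->
  [~: G, A] \subset 'C(A) -> A \subset 'C(G).
Proof.
move=> nGA coGA solG cRA; rewrite centsC -(coprime_comm_cent_prod nGA) //.
by rewrite mul_subG ?subsetIr.
Qed.

(** * Frobenius's theorem on p-nilpotent local subgroups *)

Section Frobenius.

Variables (gT : finGroupType) (p : nat).
Implicit Types G P Q U : {group gT}.

(** Downward induction on P :&: Q = D. Since 'N_G(D) is p-nilpotent, and its
    p-complement centralises D, the Sylow subgroups of 'N_G(D) that contain
    'N_P(D) and 'N_Q(D) are conjugate by an element of 'C_G(D). This links P to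
    Q by Sylow subgroups of G with successive intersections larger than D. *)
Lemma pnil_local_conj G P Q :
    (forall U, U \subset G -> p.-group U -> U :!=: 1 -> pnil p 'N_G(U)) ->
    p.-Sylow(G) P -> p.-Sylow(G) Q ->
  exists2 c, c \in 'C_G(P :&: Q) & Q :=: P :^ c.
Proof.
move=> locG; have [n] := ubnP (#|G| - #|P :&: Q|).
elim: n => // n IHn in P Q *; rewrite ltnS => leGn sylP sylQ.
have [sPG pP _] := and3P sylP; have [sQG pQ _] := and3P sylQ.
have [sPQ | not_sPQ] := boolP (P \subset Q).
  exists 1; rewrite ?group1 // conjsg1.
  by apply: (sub_pHall sylP).
have not_sQP: ~~ (Q \subset P).
  apply: contra not_sPQ => sQP; suffices ->: P :=: Q by [].
  by apply: (sub_pHall sylQ).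
have [D1 | ntD] := eqVneq (P :&: Q) 1.
  have [c Gc defQ] := Sylow_trans sylP sylQ.
  by exists c => //; rewrite D1 cent1T setIT.
pose D := (P :&: Q)%G; pose N := ('N_G(D))%G; pose E := 'O_p^'(N)%G.
have sDG: D \subset G by rewrite subIset ?sPG.
have pD: p.-group D by rewrite (pgroupS _ pP) ?subsetIl.
have nilN: pnil p N by apply: locG.
have nsDN: D <| N by rewrite normalSG.
have cED: E \subset 'C(D) by apply: norm_p'core_cent.
have sEG: E \subset G by rewrite (subset_trans (pcore_sub _ _)) ?subsetIl.
have growP (R T : {group gT}) : p.-group R -> D \subset R -> 'N_R(D) \subset T ->
   R \subset G -> ~~ (R \subset D) -> D \proper R :&: T.
  move=> pR sDR sNT sRG not_sRD.
  have: D \proper 'N_R(D).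
    by apply: nilpotent_proper_norm (pgroup_nil pR) _; rewrite properE sDR.
  by move/proper_sub_trans; apply; rewrite subsetI subsetIl.
have properD (R T : {group gT}) : D \proper R :&: T -> R \subset G -> #|G| - #|R :&: T| < n.
  move=> ltDRT sRG; apply: leq_trans leGn; apply: ltn_sub2l.
    by apply: leq_trans (proper_card ltDRT) (subset_leq_card _); rewrite subIset ?sRG.
  exact: proper_card.
have [S sylS sPS] : {S : {group gT} | p.-Sylow(N) S & 'N_P(D) \subset S}.
  by apply: Sylow_superset; rewrite ?setSI // (pgroupS _ pP) ?subsetIl.
have [e Ee sQS]: exists2 e, e \in E & 'N_Q(D) \subset S :^ e.
  have [|x Nx sQSx] := Sylow_subJ sylS _ (pgroupS (subsetIl Q 'N(D)) pQ).
    exact: setSI.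
  have defN: S * E = N.
    have nES: S \subset 'N(E).
      exact: subset_trans (pHall_sub sylS) (normal_norm (pcore_normal _ _)).
    by rewrite (normC nES); apply: pnil_mul.
  move: Nx sQSx; rewrite -{1}defN => /mulsgP[s e Ss Ee ->].
  by rewrite conjsgM conjGid //; exists e.
have pS := pHall_pgroup sylS.
have sSG : S \subset G by rewrite (subset_trans (pHall_sub sylS)) ?subsetIl.
have [R sylR sSR] := Sylow_superset sSG pS.
have ltDPR: D \proper P :&: R.
  apply: growP; rewrite ?subsetIl //; first exact: subset_trans sSR.
  by rewrite subsetI subxx.
have [c1 /setIP[Gc1 cPRc1] defR] := IHn P R (properD _ _ ltDPR sPG) sylP sylR.
have Ge: e \in G := subsetP sEG e Ee.
have sylRe : p.-Sylow(G) (R :^ e) by rewrite pHallJ.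
have ltDReQ: D \proper R :^ e :&: Q.
  rewrite setIC; apply: growP; rewrite ?subsetIr //.
    by apply: subset_trans sQS _; rewrite conjSg.
  by rewrite subsetI subxx andbT.
have sReG := pHall_sub sylRe.
have [c2 /setIP[Gc2 cRQc2] defQ] := IHn _ Q (properD (R :^ e)%G Q ltDReQ sReG) sylRe sylQ.
exists (c1 * e * c2); last by rewrite !conjsgM -defR.
rewrite inE !groupM //=.
- by apply: subsetP cPRc1; apply: centS (proper_sub _).
- exact: subsetP Ee.
- by apply: subsetP cRQc2; apply: centS (proper_sub _).
Qed.

(** If x and x ^ g are in P then x lies in P and in its conjugate by g^-1. By
    the previous lemma g is, up to an element of 'C_G(x), in the p-nilpotent
    group 'N_G(P), whose p-complement centralises P. So P controls fusion, and
    the transfer provides a proper normal subgroup to which induction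
    applies. *)
Theorem Frobenius_pnil G :
    prime p ->
    (forall U, U \subset G -> p.-group U -> U :!=: 1 -> pnil p 'N_G(U)) ->
  pnil p G.
Proof.
move=> p_pr; have [n] := ubnP #|G|; elim: n => // n IHn in G * => leGn locG.
have [P sylP] := Sylow_exists p G; have [sPG pP _] := and3P sylP.
have [P1 | ntP] := eqVneq (P : {set gT}) 1.
  apply: p'group_pnil; rewrite -partG_eq1 -(card_Hall sylP) P1 cards1 //.
have nilNP := locG P sPG pP ntP.
have nsPN: P <| 'N_G(P) by rewrite normalSG.
have [x g Px Gg Pxg | K [nsKG ltKG pGK]] := control_fusion_quotient p_pr sylP ntP.
  have PVx: x \in P :^ g^-1 by rewrite mem_conjgV.
  have [|c /setIP[Gc cPxc] defP] := pnil_local_conj locG sylP (_ : p.-Sylow(G) (P :^ g^-1)).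
    by rewrite pHallJ ?groupV.
  have Ncg: c * g \in 'N_G(P).
    rewrite inE groupM //=; apply/normP.
    by rewrite conjsgM -defP -conjsgM mulVg conjsg1.
  have sylPN: p.-Sylow('N_G(P)) P by apply: pHall_subl sylP; rewrite ?subsetIl ?normal_sub.
  have xc : x ^ c = x.
    by apply/conjg_fixP/commgP/commute_sym/(centP cPxc); rewrite inE Px.
  move: Ncg; rewrite -{1}(pnil_mul nilNP sylPN) => /mulsgP[e u Ee Pu defcg].
  exists u => //; rewrite -{1}xc -conjgM defcg conjgM; congr (_ ^ u).
  apply/conjg_fixP/commgP/commute_sym.
  by apply: (centsP (norm_p'core_cent nsPN pP)).
have sKG := normal_sub nsKG.
have nilK: pnil p K.
  apply: IHn => [|U sUK pU ntU]; first exact: leq_trans (proper_card ltKG) leGn.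
  by apply: pnilS (locG U (subset_trans sUK sKG) pU ntU); rewrite setSI.
apply: (@pnilE _ _ _ 'O_p^'(K)%G).
  by apply: char_normal_trans nsKG; apply: pcore_char.
rewrite /pHall (subset_trans (pcore_sub _ _)) //= pcore_pgroup /=.
rewrite -(Lagrange_index sKG (pcore_sub _ _)) pnatM -card_quotient ?normal_norm //.
rewrite pnatNK [X in X && _]pGK /=; have /and3P[_ _] := nilK.
by rewrite pnatNK.
Qed.

End Frobenius.

(** * Minimal non-p-nilpotent overgroups of a Sylow subgroup *)

Definition min_nonpnil (gT : finGroupType) (p : nat) (Y P : {group gT}) :=
  [/\ p.-Sylow(Y) P, ~~ pnil p Y, pnil p 'N_Y(P)
    & forall X : {group gT}, P \subset X -> X \proper Y -> pnil p X].

Section MinNonPNil.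

Variables (gT : finGroupType) (p : nat) (Y P : {group gT}).
Hypothesis minY : min_nonpnil p Y P.
Implicit Types A B C E K X : {group gT}.
Local Notation O := 'O_p(Y).

Let sylP : p.-Sylow(Y) P. Proof. by case: minY. Qed.
Let not_nilY : ~~ pnil p Y. Proof. by case: minY. Qed.
Let sPY : P \subset Y := pHall_sub sylP.
Let pP : p.-group P := pHall_pgroup sylP.
Let sOP : O \subset P := pcore_sub_Hall sylP.
Let nsOY : O <| Y := pcore_normal p Y.
Let pO : p.-group O := pcore_pgroup p Y.

(** By the Frattini argument, Y modulo the p-complement of C is a quotient of
    'N_Y(C :&: P), so this normaliser, which contains P, cannot be proper. Thus C :&: P is
    normal in Y. *)
Lemma min_pnil_pcore C : C <| Y -> pnil p C -> P :&: C \subset O.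
Proof.
move=> nsCY nilC; have [sCY nCY] := andP nsCY.
have sylCP := Sylow_setI_normal nsCY sylP.
have [defN | ltNY] := eqVproper (subsetIl Y 'N(C :&: P)).
  rewrite setIC pcore_max ?(pHall_pgroup sylCP) // /normal subIset ?sCY //=.
  by rewrite -{1}defN subsetIr.
case/negP: not_nilY; pose E := 'O_p^'(C)%G.
have nsEY : E <| Y := gFnormal_trans _ nsCY.
have nEY := normal_norm nsEY.
apply: (pnil_p'quotient nsEY); first exact: pcore_pgroup.
have sSN: C :&: P \subset 'N_Y(C :&: P).
  by rewrite subsetI normG subIset ?sCY.
have <-: E * 'N_Y(C :&: P) = Y.
  apply: etrans (Frattini_arg nsCY sylCP).
  set N := 'N_Y(_) in sSN *; rewrite -[in RHS](pnil_mul nilC sylCP) -mulgA.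
  by rewrite (mulSGid sSN).
rewrite quotientMidl.
apply: pnil_quotient; first by rewrite (subset_trans (subsetIl Y _)).
case: minY => _ _ _; apply=> //.
by rewrite subsetI sPY normsI ?normG // (subset_trans sPY).
Qed.

(** A proper C would be p-nilpotent; then P would be 'O_p(Y), hence normal in
    Y, although its normaliser is p-nilpotent. *)
Lemma min_over_Sylow C : C <| Y -> P \subset C -> C :=: Y.
Proof.
move=> nsCY sPC; case/eqVproper: (normal_sub nsCY) => // ltCY.
have nilC: pnil p C by case: minY => _ _ _; apply.
have sPO := min_pnil_pcore nsCY nilC; rewrite (setIidPl sPC) in sPO.
have defP: P :=: O by apply/eqP; rewrite eqEsubset sPO.
case/negP: not_nilY; case: minY => _ _ + _.
by rewrite (setIidPl _) // defP normal_norm.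
Qed.

(** The centraliser of A / B in Y / B is a normal subgroup that contains the
    image of P, so it is everything by [min_over_Sylow]. *)
Lemma min_comm A B :
  A <| Y -> B <| Y -> [~: A, P] \subset B -> [~: A, Y] \subset B.
Proof.
move=> /andP[sAY nAY] nsBY sAPB; have nBY := normal_norm nsBY.
have nBA := subset_trans sAY nBY; have nBP := subset_trans sPY nBY.
have nsCY: 'C_(Y / B)(A / B) <| Y / B.
  rewrite /normal subsetIl normsI ?normG // norms_cent //.
  exact: quotient_norms.
have [C defC sBC nsC] := inv_quotientN nsBY nsCY.
rewrite -quotient_cents2 // centsC -(min_over_Sylow nsC) -?defC ?subsetIr //.
have: P / B \subset C / B.
  by rewrite -defC subsetI quotientS //= centsC quotient_cents2.
by rewrite quotientSGK.
Qed.

Hypothesis nilYO : pnil p (Y / O).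

Section HallComplement.

Variable K : {group gT}.
Hypothesis hallK : p^'.-Hall(Y) K.

Let sKY := pHall_sub hallK.
Let p'K := pHall_pgroup hallK.
Let nOK : K \subset 'N(O) := subset_trans sKY (normal_norm nsOY).
Let coOK : coprime #|O| #|K| := pnat_coprime pO p'K.

Let quoK (L : {group gT}) : p^'.-Hall(Y) L -> L / O = 'O_p^'(Y / O).
Proof.
move=> hallL; apply: eq_Hall_pcore => //.
by apply: quotient_pHall => //; apply: subset_trans (pHall_sub hallL) (normal_norm nsOY).
Qed.

Lemma min_pcore_Hall_normal : O <*> K <| Y.
Proof.
have := pcore_normal p^' (Y / O).
rewrite -(quoK hallK) -cosetpre_normal (quotientGK nsOY) => nsKY.
by rewrite -(quotientYK nOK).
Qed.

Lemma min_Hall_conj (L : {group gT}) : p^'.-Hall(Y) L -> exists2 x, x \in O & L :=: K :^ x.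
Proof.
move=> hallL; apply: SchurZassenhaus_trans_sol => //; first exact: pgroup_sol pO.
  rewrite -quotientSK ?(subset_trans (pHall_sub hallL) (normal_norm nsOY)) //.
  by rewrite (quoK hallL) (quoK hallK).
by rewrite (card_Hall hallL) (card_Hall hallK).
Qed.

(** The Frattini argument for K, with the Schur-Zassenhaus theorem in O <*> K
    in the role of Sylow's theorem. *)
Lemma min_Hall_Frattini : O * 'N_Y(K) = Y.
Proof.
apply/eqP; rewrite eqEsubset mul_subG ?(normal_sub nsOY) ?subsetIl //=.
apply/subsetP=> y Yy; have [|x Ox defKy] := @min_Hall_conj (K :^ y)%G.
  by rewrite pHallJ.
have nON : 'N_Y(K) \subset 'N(O).
  exact: subset_trans (subsetIl _ _) (normal_norm nsOY).
rewrite -(normC nON).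
rewrite -[y](mulgKV x) mem_mulg // inE groupM ?groupV //=; last first.
  exact: subsetP (normal_sub nsOY) x Ox.
by apply/normP; rewrite conjsgM defKy conjsgK.
Qed.

Lemma min_Sylow_Frattini : O * 'N_P(K) = P.
Proof.
have defNP: 'N_Y(K) :&: P = 'N_P(K) by rewrite setIAC (setIidPr sPY).
by rewrite -defNP group_modl // min_Hall_Frattini (setIidPr sPY).
Qed.

(** Otherwise K would be characteristic in O <*> K, hence normal in Y. *)
Lemma min_Hall_not_cent : ~~ (K \subset 'C(O)).
Proof.
apply: contra not_nilY => cOK; have nsOKY := min_pcore_Hall_normal.
apply: (pnilE _ hallK); apply: (char_normal_trans _ nsOKY).
have nsK: K <| O <*> K.
  by rewrite /normal joing_subr join_subG normG andbT centsC in cOK *; apply: cents_norm.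
have hallKOK: p^'.-Hall(O <*> K) K.
  by apply: pHall_subl hallK; rewrite ?joing_subr ?(normal_sub nsOKY).
have := pcore_char p^' (O <*> K).
by rewrite (normal_Hall_pcore hallKOK).
Qed.

(** P <*> C contains P, so C can fail to be p-nilpotent only if P <*> C = Y.
    Then Y / C is a p-group and K is contained in C, against
    [min_Hall_not_cent]. *)
Lemma min_cent_pnil C : C <| Y -> C \subset 'C(O) -> pnil p C.
Proof.
move=> nsCY cOC; have [sCY nCY] := andP nsCY.
have nCP := subset_trans sPY nCY.
have sPCY: P <*> C \subset Y by rewrite join_subG sPY.
apply: (@pnilS _ _ (P <*> C)%G); rewrite ?joing_subr //.
case: minY => _ _ _; apply; rewrite ?joing_subl // properEneq sPCY andbT.
apply: contraNneq min_Hall_not_cent => defY; apply: subset_trans cOC.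
apply: (p'group_sub_pquo nsCY) sKY p'K.
by rewrite -defY quotientYidr // quotient_pgroup.
Qed.

Lemma min_pcore_prod : [~: O, K] * 'C_O(K) = O.
Proof. by apply: coprime_comm_cent_prod => //; apply: pgroup_sol pO. Qed.

Lemma min_cent_norm : 'C_O(K) \subset 'N_P(K).
Proof. by rewrite setISS // cent_sub. Qed.

End HallComplement.

Lemma min_Hall_exists : exists K : {group gT}, p^'.-Hall(Y) K.
Proof.
have [M defM sOM nsMY] := inv_quotientN nsOY (pcore_normal p^' (Y / O)).
have nsOM : O <| M := normalS sOM (normal_sub nsMY) nsOY.
have hallM: p.-Hall(M) O.
  rewrite /pHall sOM pO /= -card_quotient ?normal_norm // -defM.
  exact: pcore_pgroup.
have [K] := splitsP (SchurZassenhaus_split (pHall_Hall hallM) nsOM).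
rewrite (compl_pHall _ hallM) => hallK.
exists K; have [sKM p'K _] := and3P hallK.
have nilYO' : p^'^'.-nat #|Y : M|.
  have /and3P[_ _] := nilYO.
  rewrite defM /= index_quotient_eq ?(normal_norm nsOY) ?(normal_sub nsMY) //.
  by rewrite subIset // sOM orbT.
rewrite pHallE (subset_trans sKM (normal_sub nsMY)) /= (card_Hall hallK).
by rewrite -(Lagrange (normal_sub nsMY)) partnM // [X in _ == (_ * X)%N]part_p'nat ?muln1.
Qed.

End MinNonPNil.

(** * Thompson's replacement theorem *)

Definition max_abelian (gT : finGroupType) (P A : {set gT}) :=
  [&& A \subset P, abelian A &
      [forall B : {group gT}, (B \subset P) && abelian B ==> (#|B| <= #|A|)]].

Section Replacement.

Variable gT : finGroupType.
Implicit Types A B P V M : {group gT}.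

Lemma max_abelianP P A :
  reflect [/\ A \subset P, abelian A &
             forall B, B \subset P -> abelian B -> #|B| <= #|A|]
          (max_abelian P A).
Proof.
apply: (iffP and3P) => [] [sAP abA maxA]; split=> //.
  by move=> B sBP abB; move/forallP/(_ B): maxA; rewrite sBP abB.
by apply/forallP=> B; apply/implyP=> /andP[]; apply: maxA.
Qed.

Lemma max_abelian_cent P A x : max_abelian P A -> x \in P -> A \subset 'C[x] -> x \in A.
Proof.
case/max_abelianP=> sAP abA maxA Px cAx.
have abAx : abelian (A <*> <[x]>).
  by rewrite abelianY abA cycle_abelian cycle_subG -sub_cent1.
have /maxA-/(_ abAx) leA: A <*> <[x]> \subset P by rewrite join_subG sAP cycle_subG.
suffices ->: A :=: A <*> <[x]> by rewrite mem_gen // inE cycle_id orbT.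
by apply/eqP; rewrite eqEcard joing_subl.
Qed.

(** The map sending a to [~ x, a] is injective from the cosets of 'C_A(M) to
    those of A :&: M: if [~ x, a] and [~ x, b] agree modulo A then
    w = a * b^-1 satisfies [~ x, w] \in A, and [~ x, w * e] = [~ x, e * w]
    for e in A then shows that w commutes with all the generators [~ x, e]
    of M. *)
Lemma abelian_comm_index A V M x :
    abelian A -> abelian V -> A \subset 'N(V) -> x \in V ->
    M :=: <<[set [~ x, a] | a in A]>> ->
  #|A : 'C_A(M)| <= #|M : A :&: M|.
Proof.
move=> abA abV nVA Vx defM.
have sMV: M \subset V.
  rewrite defM gen_subG; apply/subsetP=> _ /imsetP[a Aa ->].
  by rewrite commgEl groupM ?groupV // memJ_norm ?(subsetP nVA).
have Mx a : a \in A -> [~ x, a] \in M by move=> Aa; rewrite defM mem_gen ?imset_f.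
pose f (C : {set gT}) := (A :&: M) :* [~ x, repr C].
have injf : {in rcosets 'C_A(M) A &, injective f}.
  move=> _ _ /rcosetsP[a Aa ->] /rcosetsP[b Ab ->]; rewrite /f.
  case: repr_rcosetP => c Cc; case: repr_rcosetP => d Cd.
  have ->: 'C_A(M) :* a = 'C_A(M) :* (c * a) by rewrite rcosetM (rcoset_id Cc).
  have ->: 'C_A(M) :* b = 'C_A(M) :* (d * b) by rewrite rcosetM (rcoset_id Cd).
  have Aca : c * a \in A by rewrite groupM // (subsetP _ c Cc) ?subsetIl.
  have Adb : d * b \in A by rewrite groupM // (subsetP _ d Cd) ?subsetIl.
  (* the representatives of the cosets may be taken to be a and b *)
  move: (c * a) (d * b) Aca Adb => {Aa Ab}a {}b Aa Ab eq_ab; apply/rcoset_eqP.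
  rewrite mem_rcoset; set w := a * b^-1.
  have Aw: w \in A by rewrite groupM ?groupV.
  have commA y : y \in A -> [~ x, y] \in V by move/Mx/(subsetP sMV).
  have Axw: [~ x, w] \in A.
    have: [~ x, a] \in A :* [~ x, b].
      by apply: subsetP (_ : (A :&: M) :* [~ x, b] \subset _) _ _;
         rewrite ?mulSg ?subsetIl // -eq_ab rcoset_refl.
    rewrite -[a](mulgKV b) -/w commgMJ mem_rcoset.
    rewrite (centsP abV _ (commA b Ab)) ?mulgK ?memJ_norm ?(subsetP nVA) ?commA //.
    by rewrite (subsetP (normG A)).
  rewrite inE Aw /= defM cent_gen; apply/centP=> _ /imsetP[e Ae ->].
  apply/commute_sym/commgP/conjg_fixP; apply: (mulgI [~ x, w]).
  rewrite -commgMJ (centsP abA e Ae w Aw) commgMJ.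
  rewrite (centsP abV _ (commA w Aw) _ (commA e Ae)); congr (_ * _).
  by apply/conjg_fixP/commgP; apply: (centsP abA).
rewrite /indexg -(card_in_imset injf); apply: subset_leq_card.
apply/subsetP=> _ /imsetP[_ /rcosetsP[a Aa ->] ->]; rewrite /f.
case: repr_rcosetP => c /setIP[Ac _].
by apply/rcosetsP; exists [~ x, c * a]; rewrite // Mx ?groupM.
Qed.

(** Choose x in V outside N = 'N_V(A) whose image is central in (V <*> A) / N,
    and let M be generated by the commutators of x with A. As M is in N,
    the abelian group B = M * 'C_A(M) normalises A. It is as large as A by [abelian_comm_index], and B :&: V contains both A :&: V and
    M, which is not inside A because x does not normalise A. *)
Theorem Thompson_replacement (p : nat) P A V :
    p.-group P -> max_abelian P A -> V <| P -> abelian V ->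
    ~~ (V \subset 'N(A)) ->
  exists B, [/\ max_abelian P B, B \subset 'N(A) & #|A :&: V| < #|B :&: V|].
Proof.
move=> pP maxA /andP[sVP nVP] abV not_nAV.
have [sAP abA leA] := max_abelianP _ _ maxA.
have nVA := subset_trans sAP nVP.
pose N := ('N_V(A))%G; have sNV : N \subset V := subsetIl _ _.
have nNV: V \subset 'N(N) by rewrite cents_norm // (sub_abelian_cent2 abV).
have nNA: A \subset 'N(N) by rewrite normsI // normsG // normG.
have nNVA : V <*> A \subset 'N(N) by rewrite join_subG nNV.
have nsVVA: V / N <| (V <*> A) / N.
  by rewrite quotient_normal // /normal joing_subl join_subG normG.
have ntV : V / N != 1.
  rewrite -subG1 quotient_sub1 //; apply: contra not_nAV => /subset_trans; apply.
  exact: subsetIr.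
have nilVA: nilpotent ((V <*> A) / N).
  by rewrite quotient_nil // (pgroup_nil (pgroupS _ pP)) // join_subG sVP.
have: (V / N) :&: 'Z((V <*> A) / N) != 1 by apply: meet_center_nil.
case/trivgPn=> _ /setIP[/morphimP[x Nx Vx ->] Zx] ntx.
have N'x: x \notin N by apply: contra ntx => Nnx; apply/eqP/coset_id.
have Nxa a : a \in A -> [~ x, a] \in N.
  move=> Aa; have VAa: a \in V <*> A by rewrite mem_gen // inE Aa orbT.
  have Na := subsetP nNVA a VAa.
  apply: coset_idr; first by rewrite groupR.
  rewrite morphR //; apply/eqP/commgP; case/setIP: Zx => _ /centP; apply.
  exact: mem_quotient.
pose M := <<[set [~ x, a] | a in A]>>%G.
have sMN: M \subset N by rewrite gen_subG; apply/subsetP=> _ /imsetP[a Aa ->]; apply: Nxa.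
have sMV := subset_trans sMN sNV.
have not_sMA: ~~ (M \subset A).
  apply: contra N'x => sMA; rewrite inE Vx; apply/normP/eqP.
  rewrite eqEcard cardJg leqnn andbT; apply/subsetP=> _ /imsetP[a Aa ->].
  rewrite conjg_mulR groupM // -invgR groupV (subsetP sMA) //.
  by rewrite mem_gen ?imset_f.
have abM: abelian M := abelianS sMV abV.
have cMC: 'C_A(M) \subset 'C(M) := subsetIr _ _.
pose B := (M <*> 'C_A(M))%G.
have abB: abelian B.
  by rewrite /= abelianY abM (abelianS (subsetIl _ _) abA).
have sBP: B \subset P by rewrite join_subG (subset_trans sMV) // subIset ?sAP.
have defCM : 'C_A(M) :&: M = A :&: M.
  by rewrite setIAC (setIidPl _) //; apply: subset_trans (subsetIr _ _) abM.
have leAB: #|A| <= #|B|.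
  rewrite -(Lagrange (subsetIl A 'C(M))) /= cent_joinEr //.
  have := mul_cardG M 'C_A(M)%G; rewrite [M :&: _]setIC defCM /=.
  rewrite -(Lagrange (subsetIr A M)) -mulnA mulnC => /eqP.
  rewrite eqn_pmul2r // => /eqP <-; rewrite mulnC leq_mul2r.
  by rewrite (abelian_comm_index abA abV nVA Vx) ?orbT.
exists B; split.
- apply/max_abelianP; split=> // C sCP abC.
  exact: leq_trans (leA C sCP abC) leAB.
- rewrite join_subG (subset_trans sMN) ?subsetIr // subIset //.
  by rewrite normG.
apply: proper_card; rewrite properE; apply/andP; split.
  rewrite subsetI subsetIr andbT (subset_trans _ (joing_subr _ _)) //.
  rewrite setIS // (subset_trans abV) // centS //.
apply: contra not_sMA => /(subset_trans _); move/(_ M).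
by rewrite subsetI joing_subl sMV => /(_ isT)/subset_trans-> //; apply: subsetIl.
Qed.

End Replacement.

(** * Quadratic action in odd characteristic *)

Section QuadraticRing.

Import GRing.Theory.
Local Open Scope ring_scope.

Variables (R : nzRingType) (p s : nat).
Hypotheses (pcharRp : p \in [pchar R]) (p_odd : odd p) (s_gt0 : (0 < s)%N).

(** Commuting fixed points of the power map of exponent p ^ s form a ring
    without nilpotent elements. Elements of order prime to p are fixed by it
    for a suitable s. *)
Definition Frob_fixed (x : R) := x ^+ (p ^ s) = x.

Lemma Frob_fixedB x y :
  GRing.comm x y -> Frob_fixed x -> Frob_fixed y -> Frob_fixed (x - y).
Proof.
rewrite /Frob_fixed => cxy {2}<- {2}<-.
elim: s => [|t IHt]; first by rewrite !expr1.
rewrite expnSr !exprM IHt -!(pFrobenius_autE pcharRp) pFrobenius_autB_comm //.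
exact/commrX/commr_sym/commrX/commr_sym.
Qed.

Lemma Frob_fixed_nil x : Frob_fixed x -> x * x = 0 -> x = 0.
Proof.
move=> fx xx0; have lt1ps: (1 < p ^ s)%N.
  by rewrite -(exp1n s) ltn_exp2r // prime_gt1 // (pcharf_prime pcharRp).
by rewrite -fx -(subnKC lt1ps) exprD expr2 xx0 mul0r.
Qed.

Lemma double_eq0 (x : R) : x + x = 0 -> x = 0.
Proof.
move=> xx0; rewrite -(mulr1n x).
have := mulrn_pchar pcharRp x; rewrite -(odd_double_half p) p_odd /= mulrnDr.
by rewrite -mul2n mulrnA mulr2n xx0 mul0rn addr0.
Qed.

Variable n : R.
Hypothesis n2 : n * n = 0.
Local Notation u := (1 + n).
Local Notation v := (1 - n).

(** The unipotent element u has inverse v, so the first three conditions say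
    that e and its conjugates by u and by v commute with each other. *)
Definition conj_comm (e : R) :=
  [/\ GRing.comm e (v * e * u), GRing.comm e (u * e * v),
      GRing.comm (v * e * u) (u * e * v) & Frob_fixed e].

Lemma uvK : u * v = 1.
Proof. by rewrite mulrBr mulr1 mulrDl mul1r n2 addr0 addrK. Qed.

Lemma vuK : v * u = 1.
Proof. by rewrite mulrDr mulr1 mulrBl mul1r n2 subr0 subrK. Qed.

Lemma Frob_fixed_conj a b e : a * b = 1 -> Frob_fixed e -> Frob_fixed (b * e * a).
Proof.
rewrite /Frob_fixed => ab1 fe; have ps_gt0 : (0 < p ^ s)%N.
  by rewrite expn_gt0 prime_gt0 // (pcharf_prime pcharRp).
rewrite -[in RHS]fe; case: (p ^ s)%N ps_gt0 => // k _.
elim: k => [|k IHk]; first by rewrite !expr1.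
rewrite exprS IHk [e ^+ k.+2]exprS.
by rewrite -!mulrA (mulrA a) ab1 mul1r !mulrA.
Qed.

(** The second difference of the three conjugates of e is -2 n e n. It is
    fixed by the power map, being a combination of commuting fixed points, and
    its square is zero; as 2 is invertible, n e n = 0. *)
Lemma quadratic_sandwich e : conj_comm e -> n * e * n = 0.
Proof.
case=> c1 c2 c12 fe; pose d := e * u - u * e.
have E1: v * e * u = e + v * d.
  by rewrite mulrBr !mulrA vuK mul1r [RHS]addrC subrK.
have E2: u * e * v = e - d * v.
  by rewrite mulrBl -!mulrA uvK mulr1 subKr.
have dE: d = e * n - n * e.
  by rewrite /d mulrDr mulrDl mulr1 mul1r opprD addrACA subrr add0r.
clearbody d.
have F1: Frob_fixed (v * e * u) by apply: Frob_fixed_conj uvK fe.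
have F2: Frob_fixed (u * e * v) by apply: Frob_fixed_conj vuK fe.
have nd: n * d = n * e * n by rewrite dE mulrBr !mulrA n2 mul0r subr0.
have dn: d * n = - (n * d).
  by rewrite nd dE mulrBl -!mulrA n2 mulr0 sub0r.
have defx: (v * e * u - e) - (e - u * e * v) = - (n * d + n * d).
  rewrite E1 E2 subKr [e + _]addrC addrK mulrBl mulrBr mul1r mulr1.
  by rewrite dn opprK !opprD addrACA subrr add0r.
have: Frob_fixed (- (n * d + n * d)).
  have cXe: GRing.comm (v * e * u - e) e by apply: commr_sym; apply: commrB.
  have cXY: GRing.comm (v * e * u - e) (u * e * v).
    by apply: commr_sym; apply: commrB; apply: commr_sym.
  rewrite -defx; apply: Frob_fixedB; first exact: commrB.
    by apply: Frob_fixedB => //; apply: commr_sym.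
  exact: Frob_fixedB.
move/Frob_fixed_nil => /(_ _) nil0.
rewrite -nd; apply: double_eq0; apply/eqP; rewrite -oppr_eq0; apply/eqP/nil0.
rewrite mulrNN mulrDr mulrDl.
have ->: n * d * (n * d) = 0.
  by rewrite -mulrA (mulrA d) dn mulNr mulrN -mulrA mulrA n2 mul0r oppr0.
by rewrite !addr0.
Qed.

Lemma conj_commM e : conj_comm e -> conj_comm (e * e).
Proof.
case=> c1 c2 c12 fe.
have eeE a b : a * b = 1 -> b * (e * e) * a = b * e * a * (b * e * a).
  by move=> ab1; rewrite -!mulrA (mulrA a) ab1 mul1r.
have commMM a b : GRing.comm a b -> GRing.comm (a * a) (b * b).
  by move=> cab; apply: commrM; apply: commr_sym; apply: commrM; apply: commr_sym.
rewrite /conj_comm (eeE u v uvK) (eeE v u vuK); split; try exact: commMM.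
by rewrite /Frob_fixed exprMn_comm ?fe.
Qed.

(** Once n e n = 0 the conjugate of e by u is e + (e n - n e). The difference
    is fixed by the power map, and its square is zero because n e n and
    n (e e) n vanish. *)
Theorem quadratic_comm e : conj_comm e -> GRing.comm e n.
Proof.
move=> Ce; have nen := quadratic_sandwich Ce.
have neen := quadratic_sandwich (conj_commM Ce).
case: Ce => c1 c2 c12 fe; pose d := e * n - n * e.
have F1: Frob_fixed (v * e * u) by apply: Frob_fixed_conj uvK fe.
have: Frob_fixed (v * e * u - e) by apply: Frob_fixedB => //; apply: commr_sym.
have ->: v * e * u - e = d.
  rewrite mulrDr mulr1 mulrBl mul1r mulrBl nen subr0 addrAC addrAC.
  by rewrite addrC addrA addrA addNr add0r addrC.
move=> fd; apply/eqP; rewrite -subr_eq0; apply/eqP; apply: Frob_fixed_nil fd _.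
rewrite mulrBl !mulrBr -!mulrA (mulrA n e n) nen mulr0 sub0r.
rewrite (mulrA n n e) n2 mul0r mulr0 oppr0 sub0r.
rewrite (mulrA e e n) (mulrA n) neen sub0r opprK.
by rewrite (mulrA e n e) (mulrA n) (mulrA n e n) nen mul0r.
Qed.

End QuadraticRing.

Section QuadraticGroup.

Import GRing.Theory.
Local Open Scope ring_scope.

Variables (gT : finGroupType) (p : nat) (G V : {group gT}).
Hypotheses (p_odd : odd p) (abelV : p.-abelem V) (ntV : V :!=: 1%g).
Hypothesis nVG : G \subset 'N(V).

Local Notation rV := (abelem_repr abelV ntV nVG).

(** The kernel of the representation of G on V is the centraliser of V. *)
Lemma abelem_repr_comm_mod x y : x \in G -> y \in G ->
  ([~ x, y]%g \in 'C(V)%g) = (rV x *m rV y == rV y *m rV x).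
Proof.
move=> Gx Gy; have Gxy: [~ x, y]%g \in G by rewrite groupR.
have ->: ([~ x, y]%g \in 'C(V)%g) = ([~ x, y]%g \in rker rV).
  by rewrite rker_abelem inE Gxy.
rewrite -!repr_mxM //; apply/rkerP/eqP=> [[_ ] | eq_xy].
  by move=> Rxy; rewrite (commgC x y) (repr_mxM _ (groupM Gy Gx)) // Rxy mulmx1.
split=> //.
have: rV (y * x)%g *m rV [~ x, y]%g = rV (y * x)%g.
  by rewrite -(repr_mxM _ (groupM Gy Gx) Gxy) -commgC.
by move/(canRL (mulKmx (repr_mx_unit rV (groupM Gy Gx)))) ->; rewrite mulVmx ?repr_mx_unit ?groupM.
Qed.

(** In the representation on V, the element a is 1 + n with n * n = 0, and the
    image e of x satisfies e ^+ (p ^ s) = e, where s is such that p ^ s is 1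
    modulo the order of x; so [quadratic_comm] applies. *)
Theorem quadratic_cent a x :
    a \in G -> x \in G -> p^'.-elt x ->
    (forall w, w \in V -> [~ w, a, a]%g = 1%g) ->
    [~ x, x ^ a]%g \in 'C(V)%g -> [~ x, x ^ a^-1]%g \in 'C(V)%g ->
    [~ x ^ a, x ^ a^-1]%g \in 'C(V)%g ->
  [~ x, a]%g \in 'C(V)%g.
Proof.
move=> Ga Gx p'x quad_a; have [p_pr _ _] := pgroup_pdiv (abelem_pgroup abelV) ntV.
have Gxa : (x ^ a)%g \in G by rewrite groupJ.
have Gxb : (x ^ a^-1)%g \in G by rewrite groupJ ?groupV.
rewrite (abelem_repr_comm_mod Gx Gxa) (abelem_repr_comm_mod Gx Gxb).
rewrite (abelem_repr_comm_mod Gxa Gxb) (abelem_repr_comm_mod Gx Ga).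
move=> /eqP c1 /eqP c2 /eqP c12.
pose n := rV a - 1.
have rVn w : rVabelem abelV ntV (w *m n) = [~ rVabelem abelV ntV w, a]%g.
  rewrite mulmxBr mulmx1 rVabelemD rVabelemN rVabelemJ // commgEl.
  apply: (centsP (abelem_abelian abelV)); rewrite ?groupV ?memJ_norm ?mem_rVabelem //.
  exact: subsetP nVG a Ga.
have n2: n * n = 0.
  apply/row_matrixP=> i; apply: (@rVabelem_inj _ _ _ abelV ntV).
  rewrite row0 rVabelem0 rowE mulmxA !rVn quad_a //; exact: mem_rVabelem.
have uE: 1 + n = rV a by rewrite addrC subrK.
have vE: 1 - n = rV a^-1%g.
  have Va: rV a^-1%g * (1 + n) = 1.
    by rewrite uE -[_ * _]/(_ *m _) -repr_mxM ?groupV // mulVg repr_mx1.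
  by have /(congr1 ( *%R^~ (1 - n))) := Va; rewrite /= -mulrA (uvK n2) mulr1 mul1r => ->.
(* p is prime to the order of x, so p ^ totient #[x] is 1 modulo this order *)
pose s := totient #[x].
have s_gt0: (0 < s)%N by rewrite totient_gt0 order_gt0.
have pcharM: p \in [pchar 'M['F_p]_('dim V)].
  by rewrite pchar_lalg pchar_Fp.
have Ce: conj_comm p s n (rV x).
  have Xa: rV a^-1%g * rV x * rV a = rV (x ^ a)%g.
    by rewrite -[LHS]/(rV a^-1%g *m rV x *m rV a) conjgE -!repr_mxM ?groupM ?groupV // mulgA.
  have XVa: rV a * rV x * rV a^-1%g = rV (x ^ a^-1)%g.
    by rewrite -[LHS]/(rV a *m rV x *m rV a^-1%g) conjgE invgK -!repr_mxM ?groupM ?groupV // mulgA.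
  rewrite /conj_comm uE vE Xa XVa; split=> //; rewrite /Frob_fixed.
  rewrite -repr_mxX // -[in RHS](expg1 x); congr (rV _); apply/eqP.
  rewrite eq_expg_mod_order Euler_exp_totient //.
  by rewrite prime_coprime // -p'natE.
have := quadratic_comm pcharM p_odd s_gt0 n2 Ce; rewrite /GRing.comm => cen.
apply/eqP; rewrite -[_ *m _]/(rV x * rV a) -[RHS]/(rV a * rV x) -uE.
by rewrite mulrDl mulrDr cen mul1r mulr1.
Qed.

End QuadraticGroup.

(** * The Thompson subgroup *)

Definition char_pnil (gT : finGroupType) (p : nat) (G P : {group gT}) :=
  forall C : {group gT}, C \char P -> C :!=: 1 -> pnil p 'N_G(C).

Definition Thompson_J (gT : finGroupType) (P : {set gT}) :=
  <<\bigcup_(A : {group gT} | max_abelian P A) A>>.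

Canonical Thompson_J_group (gT : finGroupType) (P : {set gT}) :=
  Eval hnf in [group of Thompson_J P].

Section ThompsonJ.

Variable gT : finGroupType.
Implicit Types A P O : {group gT}.

Lemma max_abelian_exists P : exists A, max_abelian P A.
Proof.
have P1 : (1%G \subset P) && abelian (1%G : {group gT}) by rewrite sub1G abelian1.
case: (@arg_maxnP _ 1%G (fun A : {group gT} => (A \subset P) && abelian A)
         (fun A : {group gT} => #|A|) P1) => A /andP[sAP abA] maxA.
by exists A; apply/max_abelianP; split=> // B sBP abB; apply: maxA; rewrite sBP.
Qed.

Lemma max_abelian_morph P A (f : {morphism P >-> gT}) :
  'injm f -> f @* P = P -> max_abelian P A -> max_abelian P (f @* A).
Proof.
move=> injf fP /max_abelianP[sAP abA maxA]; apply/max_abelianP; split.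
- by rewrite -[in X in _ \subset X]fP morphimS.
- exact: morphim_abelian.
by move=> B sBP abB; rewrite card_injm //; apply: maxA.
Qed.

Lemma Thompson_J_char P : Thompson_J P \char P.
Proof.
apply/charP; split.
  rewrite gen_subG; apply/bigcupsP=> A /max_abelianP[]; by [].
move=> f injf fP; have sJP : Thompson_J P \subset P.
  by rewrite gen_subG; apply/bigcupsP=> A /max_abelianP[].
apply/eqP; rewrite eqEcard card_injm // leqnn andbT.
rewrite sub_morphim_pre // gen_subG; apply/bigcupsP=> A maxA.
have [sAP _ _] := max_abelianP _ _ maxA.
rewrite -sub_morphim_pre // sub_gen //.
by rewrite (bigcup_sup (f @* A)%G) //; apply: max_abelian_morph.
Qed.

Lemma Thompson_J_neq1 (p : nat) P : p.-group P -> P :!=: 1 -> Thompson_J P != 1.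
Proof.
move=> pP ntP; have [A maxA] := max_abelian_exists P.
have sAJ : A \subset Thompson_J P by rewrite sub_gen // (bigcup_sup A).
have [_ _ /(_ 'Z(P)%G (center_sub P) (center_abelian P))] := max_abelianP _ _ maxA.
rewrite leqNgt; apply: contraNneq => J1; rewrite J1 in sAJ.
rewrite (trivgP sAJ) cards1 cardG_gt1.
by rewrite (center_nil_eq1 (pgroup_nil pP)).
Qed.

(** Conjugates of these abelian subgroups stay inside O, hence inside P, so
    they are again abelian subgroups of P of largest order. *)
Lemma Thompson_J_norm P O y :
  O \subset P -> Thompson_J P \subset O -> y \in 'N(O) -> y \in 'N(Thompson_J P).
Proof.
move=> sOP sJO nOy; rewrite inE -genJ gen_subG; apply/subsetP=> z.
rewrite mem_conjg => /bigcupP[A maxA Azy].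
have [sAP abA leA] := max_abelianP _ _ maxA.
have sAO : A \subset O.
  by apply: subset_trans sJO; rewrite sub_gen // (bigcup_sup A).
rewrite mem_gen //; apply/bigcupP; exists (A :^ y)%G; last by rewrite mem_conjg.
apply/max_abelianP; split; rewrite ?abelianJ //; last by move=> B; rewrite cardJg; apply: leA.
by apply: subset_trans sOP; rewrite -(normP nOy) conjSg.
Qed.

End ThompsonJ.

(** * Thompson's normal p-complement theorem *)

Section Endgame.

Variables (gT : finGroupType) (p : nat) (Y P K : {group gT}).
Hypothesis p_odd : odd p.
Hypothesis minY : min_nonpnil p Y P.
Hypothesis nilYO : pnil p (Y / 'O_p(Y)).
Hypothesis hallK : p^'.-Hall(Y) K.
Implicit Types A B C D E X : {group gT}.
Local Notation O := 'O_p(Y).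

Let sylP : p.-Sylow(Y) P. Proof. by case: minY. Qed.
Let not_nilY : ~~ pnil p Y. Proof. by case: minY. Qed.
Let sPY : P \subset Y := pHall_sub sylP.
Let pP : p.-group P := pHall_pgroup sylP.
Let sOP : O \subset P := pcore_sub_Hall sylP.
Let nsOY : O <| Y := pcore_normal p Y.
Let pO : p.-group O := pcore_pgroup p Y.
Let sKY := pHall_sub hallK.
Let p'K := pHall_pgroup hallK.
Let nOK : K \subset 'N(O) := subset_trans sKY (normal_norm nsOY).
Let coOK : coprime #|O| #|K| := pnat_coprime pO p'K.
Let nsOKY := min_pcore_Hall_normal nilYO hallK.

Lemma min_mulKP : K * P = Y.
Proof.
apply/eqP; rewrite eqEcard mul_subG //= TI_cardMg; last first.
  by apply: coprime_TIg; rewrite coprime_sym (pnat_coprime pP).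
by rewrite (card_Hall sylP) (card_Hall hallK) mulnC partnC.
Qed.

(** P <*> D is proper in Y, so it is p-nilpotent. Its normal p-complement
    centralises O and contains all its p'-subgroups. *)
Lemma min_inv_proper D :
  O \subset D -> D \proper O <*> K -> P \subset 'N(D) -> K :&: D \subset 'C(O).
Proof.
move=> sOD ltD nDP; have [sDOK _] := andP ltD.
pose X := (P <*> D)%G.
have sXY: X \subset Y by rewrite join_subG sPY (subset_trans sDOK) ?normal_sub.
have defD : O * (K :&: D) = D.
  by rewrite group_modl // -norm_joinEr // (setIidPr sDOK).
have cardD : #|D| = (#|O| * #|K :&: D|)%N.
  by rewrite -[in LHS]defD TI_cardMg //; apply: coprime_TIg; apply: coprimegS coOK; apply: subsetIl.
have ltXY : X \proper Y.
  rewrite properEcard sXY /=.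
  have: #|X| %| #|P| * #|K :&: D|.
    have ->: X :=: P * (K :&: D).
      by rewrite /X /= norm_joinEl // -[in LHS]defD mulgA (mulGSid sOP).
    by rewrite (mul_cardG P (K :&: D)%G) dvdn_mulr.
  move/dvdn_leq=> leX; apply: leq_ltn_trans (leX _) _; first by rewrite muln_gt0 !cardG_gt0.
  rewrite -min_mulKP TI_cardMg; last first.
    by apply: coprime_TIg; rewrite coprime_sym (pnat_coprime pP).
  rewrite mulnC ltn_pmul2r ?cardG_gt0 //.
  have := proper_card ltD; rewrite cardD norm_joinEr // TI_cardMg ?ltn_pmul2l //.
  exact: coprime_TIg.
have nilX: pnil p X by case: minY => _ _ _; apply; rewrite ?joing_subl.
have sOX: O \subset X by rewrite (subset_trans sOP) ?joing_subl.
have nsOX: O <| X by apply: normalS nsOY.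
apply: subset_trans (norm_p'core_cent nsOX pO).
rewrite (sub_Hall_pcore nilX) ?(pgroupS _ p'K) ?subsetIl //.
by rewrite subIset // joing_subr orbT.
Qed.

Lemma card_Hall_quotient B : B \subset K -> #|B / O| = #|B|.
Proof.
move=> sBK; apply/esym/card_isog/quotient_isog; first exact: subset_trans nOK.
by apply: coprime_TIg; apply: coprimegS coOK.
Qed.

(** P acts coprimely on K / O, so it normalises a Sylow r-subgroup of it for
    each prime r. If these were all proper then each would centralise O by
    [min_inv_proper], and so would K. *)
Lemma min_Hall_prime_pow : exists q : nat, q.-group K.
Proof.
have [qK | not_qK] := boolP ((pdiv #|K|).-group K); first by exists (pdiv #|K|).
case/negP: (min_Hall_not_cent minY nilYO hallK).
suffices: #|K| %| #|'C_K(O)|.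
  move/dvdn_leq => /(_ (cardG_gt0 _)) leK.
  have /eqP <-: 'C_K(O) == K by rewrite eqEcard subsetIl.
  exact: subsetIr.
apply/dvdn_partP => // r piKr.
have defKO : (O <*> K) / O = K / O by rewrite quotientYidl.
have nKO: P / O \subset 'N(K / O).
  rewrite -defKO quotient_norms // (subset_trans sPY) ?normal_norm //.
have coKP : coprime #|K / O| #|P / O|.
  rewrite coprime_sym (pnat_coprime (quotient_pgroup _ pP)) //.
  exact: quotient_pgroup.
have [Dq sylDq nDqP] := @sol_coprime_Sylow_exists _ r _ _ (quotient_sol _ (pgroup_sol pP)) nKO coKP.
have nsOOK : O <| O <*> K by rewrite /normal joing_subl join_subG normG.
have sDqOK : Dq \subset (O <*> K) / O by rewrite defKO (pHall_sub sylDq).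
have [D defD sOD sDOK] := inv_quotientS nsOOK sDqOK.
have nOD : D \subset 'N(O) := subset_trans sDOK (normal_norm nsOOK).
have nsOD : O <| D by rewrite /normal sOD.
have nDP : P \subset 'N(D).
  rewrite -(quotientGK nsOD) -defD norm_quotient_pre //.
  exact: subset_trans sPY (normal_norm nsOY).
have rP := pHall_pgroup sylDq.
have cardK : #|K| = #|K / O| by rewrite card_Hall_quotient.
have ltD : D \proper O <*> K.
  rewrite properEneq sDOK andbT; apply: contraNneq not_qK => defDOK.
  have rK: r.-group K by rewrite /pgroup cardK -defKO -defDOK -defD.
  have [r_pr _ r_dv] : [/\ prime r, 0 < #|K| & r %| #|K|].
    by move: piKr; rewrite mem_primes => /and3P.
  have K_gt1 : 1 < #|K| := leq_trans (prime_gt1 r_pr) (dvdn_leq (cardG_gt0 K) r_dv).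
  have := pgroupP rK _ (pdiv_prime K_gt1) (pdiv_dvd _).
  by rewrite inE => /eqP->.
have cKD := min_inv_proper sOD ltD nDP.
rewrite -(_ : #|K :&: D| = #|K|`_r)%N.
  by rewrite cardSg // subsetI subsetIl.
rewrite -(card_Hall_quotient (subsetIl _ _)) cardK -(card_Hall sylDq) defD.
congr #|(_ : {set _})|; rewrite -[in RHS](_ : O * (K :&: D) = D) ?quotientMidl //.
by rewrite group_modl // -norm_joinEr // (setIidPr sDOK).
Qed.

(** K is a group of prime power order, so the derived subgroup of K / O is
    proper; it is P-invariant, and [min_inv_proper] applies to its preimage. *)
Lemma min_Hall_der : K^`(1) \subset 'C(O).
Proof.
have [q qK] := min_Hall_prime_pow.
have ntK : K / O != 1.
  apply: contra (min_Hall_not_cent minY nilYO hallK).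
  rewrite -subG1 quotient_sub1 // => sKO.
  have K1: K :=: 1 by rewrite -(coprime_TIg coOK) setIC (setIidPl sKO).
  by rewrite K1 sub1G.
have defKO : (O <*> K) / O = K / O by rewrite quotientYidl.
have nsOOK : O <| O <*> K by rewrite /normal joing_subl join_subG normG.
have sDK : (K / O)^`(1) \subset (O <*> K) / O by rewrite defKO der_sub.
have [D defD sOD sDOK] := inv_quotientS nsOOK sDK.
have nOD : D \subset 'N(O) := subset_trans sDOK (normal_norm nsOOK).
have nsOD : O <| D by rewrite /normal sOD.
have nDP : P \subset 'N(D).
  rewrite -(quotientGK nsOD) -defD norm_quotient_pre //.
    exact: subset_trans sPY (normal_norm nsOY).
  have nKO: P / O \subset 'N(K / O).
    by rewrite -defKO quotient_norms // (subset_trans sPY) ?normal_norm.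
  exact: gFnorm_trans.
have ltD : D \proper O <*> K.
  rewrite -(quotient_proper nsOD nsOOK) -defD defKO.
  by rewrite (sol_der1_proper (pgroup_sol (quotient_pgroup _ qK))).
apply: subset_trans (min_inv_proper sOD ltD nDP).
rewrite subsetI der_sub -(quotientSGK _ sOD) ?(subset_trans (der_sub _ _)) //.
by rewrite -defD quotient_der /=.
Qed.

(** V is the subgroup generated by the elements of order p of 'Z(O), and C is
    its centraliser. Since V contains the corresponding subgroup of 'Z(P),
    whose normaliser is p-nilpotent, P <*> C is proper. Let A be an abelian
    subgroup of P of largest order, not contained in O, and such that A :&: V
    is as large as possible; it exists because otherwise the Thompson subgroup
    of P would be normal in Y. If V did not normalise A, a replacement B would
    be contained in O, so V would centralise B and lie in it, although B
    normalises A. Therefore A acts quadratically on V. As the image of K in Y / C is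
    abelian and O <*> K is normal in Y, [quadratic_cent] applies to the
    elements of K and A, and [~: K, A] is in C.
    The centraliser of K / C in P / C is normal in Y / C; its preimage is a
    normal p-nilpotent subgroup containing A, so A is in O after all. *)
Theorem min_char_false : char_pnil p Y P -> False.
Proof.
move=> charP.
have ntP: P :!=: 1.
  apply: contraNneq not_nilY => P1; apply: p'group_pnil.
  by rewrite -partG_eq1 -(card_Hall sylP) P1 cards1.
have [nOY sOY] := (normal_norm nsOY, normal_sub nsOY).
have sZO : 'Z(P) \subset O.
  have nsCO: 'C_Y(O) <| Y by rewrite /normal subsetIl normsI ?normG ?norms_cent.
  have nilCO: pnil p 'C_Y(O).
    by apply: (min_cent_pnil minY nilYO hallK nsCO); apply: subsetIr.
  apply: subset_trans (min_pnil_pcore minY nsCO nilCO).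
  rewrite subsetI center_sub subsetI (subset_trans (center_sub P)) //=.
  by rewrite subIset // centS ?orbT.
pose Z0 := 'Ohm_1('Z(P))%G; pose V := 'Ohm_1('Z(O))%G; pose C := ('C_Y(V))%G.
have charZ0 : Z0 \char P := char_trans (Ohm_char 1 _) (center_char P).
have ntZ0 : Z0 :!=: 1 by rewrite Ohm1_eq1 center_nil_eq1 ?(pgroup_nil pP).
have nsVY : V <| Y.
  exact: char_normal_trans (char_trans (Ohm_char 1 _) (center_char O)) nsOY.
have [sVY nVY] := andP nsVY.
have sVZO : V \subset 'Z(O) := Ohm_sub 1 _.
have cOV : V \subset 'C(O) := subset_trans sVZO (subsetIr _ _).
have sVO : V \subset O := subset_trans sVZO (subsetIl _ _).
have sZ0V : Z0 \subset V.
  apply: OhmS; rewrite subsetI sZO (subset_trans (subsetIr _ _)) //.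
  exact: centS.
have ntV : V :!=: 1 by apply: subG1_contra ntZ0.
have abelV : p.-abelem V.
  by apply: Ohm1_abelem; rewrite ?center_abelian // (pgroupS (center_sub _)).
have nsCY : C <| Y by rewrite /normal subsetIl normsI ?normG ?norms_cent.
have sCY := normal_sub nsCY; have nCY := normal_norm nsCY.
have sOC : O \subset C by rewrite subsetI sOY centsC.
have sPCY : P <*> C \subset Y by rewrite join_subG sPY.
have ltPC : P <*> C \proper Y.
  rewrite properEneq sPCY andbT; apply: contraNneq not_nilY => defY.
  apply: pnilS (charP Z0 charZ0 ntZ0).
  rewrite subsetI subxx /= -defY join_subG char_norm //.
  by rewrite (subset_trans (subsetIr _ _)) // (subset_trans (centS sZ0V)) ?cent_sub.
have nilPC : pnil p (P <*> C) by case: minY => _ _ _; apply; rewrite ?joing_subl.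
have [A0 maxA0 notA0] : exists2 A : {group gT}, max_abelian P A & ~~ (A \subset O).
  apply/exists_inP; apply: contraR not_nilY => /exists_inPn allA.
  have sJO: Thompson_J P \subset O.
    by rewrite gen_subG; apply/bigcupsP=> A maxA; have := allA A maxA; rewrite negbK.
  apply: pnilS (charP _ (Thompson_J_char P) (Thompson_J_neq1 pP ntP)).
  rewrite subsetI subxx; apply/subsetP=> y Yy.
  by apply: Thompson_J_norm sOP sJO _; apply: subsetP Yy.
pose okA (A : {group gT}) := max_abelian P A && ~~ (A \subset O).
have okA0 : okA A0 by rewrite /okA maxA0.
have [A /andP[maxA notA] leA] := @arg_maxnP _ A0 okA (fun A : {group gT} => #|A :&: V|) okA0.
have [sAP abA _] := max_abelianP _ _ maxA.
have sAY := subset_trans sAP sPY.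
have nAV : V \subset 'N(A).
  apply: contraT => not_nAV.
  have nsVP : V <| P by rewrite (normalS _ sPY) // (subset_trans sVO).
  have [B [maxB nBA ltB]] :=
    Thompson_replacement pP maxA nsVP (abelem_abelian abelV) not_nAV.
  have sBO : B \subset O.
    apply: contraLR ltB => notB; rewrite -leqNgt; apply: leA.
    by rewrite /okA maxB.
  case/negP: not_nAV; apply: subset_trans nBA; apply/subsetP=> v Vv.
  apply: (max_abelian_cent maxB); first by rewrite (subsetP sOP) ?(subsetP sVO).
  by rewrite sub_cent1 (subsetP _ v Vv) // (subset_trans cOV) ?centS.
have quadA a w : a \in A -> w \in V -> [~ w, a, a] = 1.
  move=> Aa Vw; apply/eqP/commgP; apply: (centsP abA) => //.
  by rewrite commgEr groupM // memJ_norm ?groupV // (subsetP nAV).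
have sOKC : (O <*> K)^`(1) \subset C.
  apply: der1_min; first exact: subset_trans (normal_sub nsOKY) nCY.
  rewrite quotientY ?(subset_trans sOY) ?(subset_trans sKY) // (quotientS1 sOC) joing1G.
  apply: sub_der1_abelian; rewrite subsetI (subset_trans (der_sub _ _)) //=.
  by rewrite (subset_trans min_Hall_der) ?centS.
have sKAC : [~: K, A] \subset C.
  rewrite gen_subG; apply/subsetP=> _ /imset2P[x a Kx Aa ->].
  have [Yx Ya] := (subsetP sKY x Kx, subsetP sAY a Aa).
  rewrite inE groupR //=.
  have commOK y z : y \in O <*> K -> z \in O <*> K -> [~ y, z] \in 'C(V).
    move=> OKy OKz; apply: (subsetP (subset_trans sOKC (subsetIr _ _))).
    exact: mem_commg.
  have OKx : x \in O <*> K by rewrite mem_gen // inE Kx orbT.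
  have OKJ b : b \in Y -> x ^ b \in O <*> K.
    by move=> Yb; rewrite memJ_norm // (subsetP (normal_norm nsOKY)).
  apply: (quadratic_cent p_odd abelV ntV nVY) => //.
  - exact: mem_p_elt p'K Kx.
  - by move=> w; apply: quadA.
  - by apply: commOK; rewrite ?OKJ.
  - by apply: commOK; rewrite ?OKJ ?groupV.
  - by apply: commOK; rewrite ?OKJ ?groupV.
have defKC : (O <*> K) / C = K / C.
  by rewrite quotientY ?(subset_trans sOY) ?(subset_trans sKY) // (quotientS1 sOC) joing1G.
have nsF : 'C_(P / C)(K / C) <| Y / C.
  have defYC : Y / C = (K / C) * (P / C).
    by rewrite -quotientMl ?min_mulKP // (subset_trans sKY).
  rewrite /normal subIset ?quotientS //= defYC mul_subG //.
    by apply: subset_trans (cent_sub _); rewrite centsC subsetIr.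
  rewrite normsI ?normG // norms_cent // -defKC quotient_norms //.
  exact: subset_trans sPY (normal_norm nsOKY).
have [F defF sCF nsFY] := inv_quotientN nsCY nsF.
have sFPC : F \subset P <*> C.
  have nCP := subset_trans sPY nCY.
  rewrite -(quotientSGK _ (joing_subr P C)) ?(subset_trans (normal_sub nsFY)) //.
  by rewrite -defF quotientYidr // subsetIl.
case/negP: notA; apply: subset_trans (min_pnil_pcore minY nsFY (pnilS sFPC nilPC)).
rewrite subsetI sAP -(quotientSGK _ sCF) ?(subset_trans sAY) // -defF subsetI.
by rewrite quotientS // centsC quotient_cents2r.
Qed.

End Endgame.

Section Thompson.

Variable p : nat.
Hypotheses (p_pr : prime p) (p_odd : odd p).

(** The preimage of a nontrivial characteristic subgroup of P / 'O_p(Y) is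
    normal in P and strictly contains 'O_p(Y), so its normaliser is a proper
    overgroup of P. *)
Lemma min_char_quotient (gT : finGroupType) (Y P : {group gT}) :
  min_nonpnil p Y P -> char_pnil p (Y / 'O_p(Y)) (P / 'O_p(Y)).
Proof.
move=> minY C chC ntC; have [sylP not_nilY _ _] := minY.
have sPY := pHall_sub sylP; have pP := pHall_pgroup sylP.
have sOP := pcore_sub_Hall sylP; have nsOY := pcore_normal p Y.
have nsOP := normalS sOP sPY nsOY.
have [D defC sOD nsDP] := inv_quotientN nsOP (char_normal chC).
have sDY := subset_trans (normal_sub nsDP) sPY.
have nsOD := normalS sOD sDY nsOY.
have := quotient_subnormG Y nsOD.
rewrite -defC => <-; apply: pnil_quotient.
  by rewrite (subset_trans (subsetIl _ _)) ?normal_norm.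
case: minY => _ _ _; apply; first by rewrite subsetI sPY normal_norm.
rewrite properEneq subsetIl andbT; apply: contraNneq ntC => defN.
have nsDY: D <| Y by rewrite /normal sDY -{1}defN subsetIr.
rewrite defC -subG1 quotient_sub1 ?normal_norm // pcore_max //.
exact: pgroupS (normal_sub nsDP) pP.
Qed.

(** By [Frobenius_pnil] some nontrivial p-subgroup has a normaliser N that is
    not p-nilpotent; choose it with a Sylow p-subgroup S as large as possible.
    If S is smaller than P, the normalisers in G of the characteristic
    subgroups of S contain 'N_P(S), which is larger than S, so they are
    p-nilpotent and induction in N gives a contradiction. If S = P then every
    proper overgroup of P is p-nilpotent by induction, so N = G. Then
    G / 'O_p(G) is p-nilpotent, again by induction, and [min_char_false]
    concludes. *)
Theorem Thompson_pnil (gT : finGroupType) (G P : {group gT}) :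
  p.-Sylow(G) P -> char_pnil p G P -> pnil p G.
Proof.
have [n] := ubnP #|G|; elim: n => // n IHn in gT G P *; rewrite ltnS => leGn.
move=> sylP charP; have [sPG pP _] := and3P sylP.
apply: contraT => not_nilG.
pose okU (U : {group gT}) := [&& U \subset G, p.-group U, U :!=: 1 & ~~ pnil p 'N_G(U)].
have [U0 okU0] : exists U0, okU U0.
  apply/existsP; apply: contraR not_nilG => /existsPn allU.
  apply: Frobenius_pnil => // U sUG pU ntU.
  by have := allU U; rewrite /okU sUG pU ntU /= negbK.
have [U /and4P[sUG pU ntU not_nilN] maxU] :=
  @arg_maxnP _ U0 okU (fun U : {group gT} => #|'N_G(U)|`_p)%N okU0.
have [S0 sylS0] := Sylow_exists p 'N_G(U).
have [sS0N pS0 _] := and3P sylS0.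
have [x Gx sSP] := Sylow_Jsub sylP (subset_trans sS0N (subsetIl _ _)) pS0.
pose W := (U :^ x)%G; pose S := (S0 :^ x)%G; pose N := ('N_G(W))%G.
have defN : N :=: 'N_G(U) :^ x by rewrite /= normJ -{1}(conjGid Gx) -conjIg.
have sylS : p.-Sylow(N) S by rewrite defN pHallJ2.
have not_nilNW : ~~ pnil p N by rewrite defN pnilJ.
have ntW : W :!=: 1 by rewrite -!cardG_gt1 /= cardJg in ntU *.
have pW : p.-group W by rewrite pgroupJ.
have sNG : N \subset G := subsetIl _ _.
have pS := pHall_pgroup sylS.
have [defS | ltSP] := eqVproper sSP; last first.
  case/negP: not_nilNW; apply: (IHn _ N S) => //.
    apply: leq_trans leGn; apply: proper_card; rewrite properEneq sNG andbT.
    apply: contraTneq (proper_card ltSP) => defNG.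
    by rewrite -leqNgt (card_Hall sylP) -defNG -(card_Hall sylS).
  move=> C chC ntC; apply: (@pnilS _ _ 'N_G(C)); first by rewrite setSI.
  have sCS := char_sub chC; apply: contraT => not_nilC.
  have sNP : 'N_P(S) \subset 'N_G(C).
    by rewrite setISS ?(char_norms chC).
  have /maxU: okU C.
    rewrite /okU ntC not_nilC (pgroupS sCS pS) !andbT.
    exact: subset_trans sCS (subset_trans sSP sPG).
  have -> : (#|'N_G(U)|`_p)%N = #|S| by rewrite (card_Hall sylS) defN cardJg.
  rewrite /= leqNgt => /negP[]; apply: (@leq_trans #|'N_P(S)|).
    by apply: proper_card; apply: nilpotent_proper_norm (pgroup_nil pP) ltSP.
  have pNP : p.-group 'N_P(S) := pgroupS (subsetIl _ _) pP.
  rewrite -(part_pnat_id pNP); apply: dvdn_leq; first exact: part_gt0.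
  by apply: partn_dvd; rewrite ?cardSg.
have sPN : P \subset N by rewrite -defS (pHall_sub sylS).
have over (X : {group gT}) : P \subset X -> X \proper G -> pnil p X.
  move=> sPX ltXG; have sXG := proper_sub ltXG.
  apply: (IHn _ X P); first exact: leq_trans (proper_card ltXG) leGn.
    exact: pHall_subl sylP.
  by move=> C chC ntC; apply: pnilS (charP C chC ntC); rewrite setSI.
have defNG : N :=: G.
  by case/eqVproper: sNG => // /(over _ sPN) nilN; rewrite nilN in not_nilNW.
have nsWG : W <| G.
  by rewrite /normal -{2}defNG subsetIr -(conjGid Gx) conjSg sUG.
have sWO : W \subset 'O_p(G) by apply: pcore_max.
have ntO : 'O_p(G) != 1 by apply: subG1_contra ntW.
have ntP : P :!=: 1.
  by apply: subG1_contra ntO; apply: pcore_sub_Hall sylP.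
have minG : min_nonpnil p G P by split=> //; apply: charP; rewrite ?char_refl.
have nsOG := pcore_normal p G.
have nilGO : pnil p (G / 'O_p(G)).
  apply: (IHn _ _ (P / 'O_p(G))%G); last exact: min_char_quotient.
    by apply: leq_trans leGn; apply: ltn_quotient => //; apply: normal_sub.
  by apply: quotient_pHall => //; apply: subset_trans (normal_norm nsOG).
have [K hallK] := min_Hall_exists nilGO.
by case: (min_char_false p_odd minG nilGO hallK charP).
Qed.

End Thompson.

Lemma min_nonpnil_quotient (gT : finGroupType) (p : nat) (Y P : {group gT}) :
  prime p -> odd p -> min_nonpnil p Y P -> pnil p (Y / 'O_p(Y)).
Proof.
move=> p_pr p_odd minY; have [sylP _ _ _] := minY.
apply: (Thompson_pnil p_pr p_odd _ (min_char_quotient minY)).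
apply: quotient_pHall (sylP).
exact: subset_trans (pHall_sub sylP) (normal_norm (pcore_normal _ _)).
Qed.

(** * Embedding relative to a normal subgroup *)

Definition pnil_supplemented (gT : finGroupType) (p : nat) (G H : {group gT}) :=
  exists T : {group gT}, [/\ T \subset G, H * T = G & pnil p T].

(** What is left of Pi-normality for a p-subgroup H when R is contained in all
    the subnormal supplements of H. The normaliser is taken in G, and not in
    G / K: it is that of the preimage of the intersection of the images of I
    and L. *)
Definition p_embedded (gT : finGroupType) (p : nat) (G R H : {group gT}) :=
  exists I : {group gT}, [/\ H :&: R \subset I, I \subset H &
    forall K L : {group gT}, chief_factor G K L ->
      p.-nat #|G : 'N_G(K <*> (I :&: L))|].

Section Embedding.

Variables (gT : finGroupType) (p : nat).
Implicit Types G H I K L M P Q R X : {group gT}.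

Lemma p_index_Sylow_mul G P X :
  p.-Sylow(G) P -> X \subset G -> p.-nat #|G : X| -> X * P = G.
Proof.
move=> sylP sXG pGX; have [sPG pP _] := and3P sylP.
apply/eqP; rewrite eqEcard mul_subG //=.
have leXP : #|X :&: P| <= #|X|`_p.
  have pXP: p.-group (X :&: P) := pgroupS (subsetIr _ _) pP.
  rewrite -(part_pnat_id pXP); apply: dvdn_leq; first exact: part_gt0.
  by apply: partn_dvd; rewrite ?cardSg ?subsetIl.
have eqX: (#|G|`_p^' = #|X|`_p^')%N.
  by rewrite -(Lagrange sXG) partnM // [X in (_ * X)%N]part_p'nat ?muln1 // pnatNK.
rewrite -(leq_pmul2r (cardG_gt0 (X :&: P))) -mul_cardG (card_Hall sylP).
rewrite -{1}(partnC p (cardG_gt0 G)) eqX -[in X in _ <= X](partnC p (cardG_gt0 X)).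
by rewrite [X in _ <= X]mulnC mulnA mulnAC leq_mul2r leq_mul2l leXP !orbT.
Qed.

(** G is the product of P and the normaliser of J = K <*> (I :&: L), so all
    the conjugates of J are P-conjugates and lie in Q. Their join is normal in
    G, contained in L, and strictly contains K. *)
Lemma p_embedded_chief G P R H K L Q :
    p.-Sylow(G) P -> H \subset P -> p_embedded p G R H -> chief_factor G K L ->
    ~~ (H :&: L :&: R \subset K) -> P \subset 'N(Q) -> K \subset Q ->
    H :&: L \subset Q ->
  L \subset Q.
Proof.
move=> sylP sHP [I [sHRI sIH embI]] chiefKL not_sK nQP sKQ sHLQ.
have [maxK nsLG] := andP chiefKL; have [sLG nLG] := andP nsLG.
have sKL := maxnormal_sub maxK.
pose J := (K <*> (I :&: L))%G.
have sJL : J \subset L by rewrite join_subG sKL subsetIr.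
have sJQ : J \subset Q by rewrite join_subG sKQ (subset_trans (setSI _ sIH)).
have defG := p_index_Sylow_mul sylP (subsetIl _ _) (embI K L chiefKL).
pose M := <<class_support J G>>%G.
have sJM : J \subset M.
  by rewrite sub_gen //; apply: sub_class_support.
have nMG : G \subset 'N(M) by rewrite norms_gen ?class_support_norm.
have sML : M \subset L.
  rewrite gen_subG class_supportEr; apply/bigcupsP=> g Gg.
  by rewrite -(normsP nLG g Gg) conjSg.
have sMQ : M \subset Q.
  rewrite gen_subG class_supportEr; apply/bigcupsP=> g.
  rewrite -defG => /mulsgP[n u /setIP[_ /normP nJn] Pu ->].
  by rewrite conjsgM nJn -(normsP nQP u Pu) conjSg.
have ltKM : K \proper M.
  rewrite properE (subset_trans (joing_subl _ _) sJM) /=.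
  apply: contra not_sK => /(subset_trans sJM); apply: subset_trans.
  rewrite (subset_trans _ (joing_subr _ _)) // subsetI -setIA [L :&: R]setIC setIA.
  by rewrite (subset_trans (subsetIl _ _) sHRI) subsetIr.
have [defL | ltML] := eqVproper sML; first by rewrite -defL.
have [_ maxKX] := maxgroupP maxK.
have := maxKX M _ (proper_sub ltKM); rewrite ltML nMG => /(_ isT) defM.
by rewrite defM properxx in ltKM.
Qed.

Lemma quotient_supplemented G H M :
  M <| G -> H \subset G -> pnil_supplemented p G H ->
  pnil_supplemented p (G / M) (H / M).
Proof.
move=> /andP[_ nMG] sHG [T [sTG defG nilT]]; exists (T / M)%G; split.
- exact: quotientS.
- by rewrite -quotientMl ?defG // (subset_trans sHG).
by apply: pnil_quotient => //; apply: subset_trans nMG.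
Qed.

Lemma chief_factor_quotient G M (Kb Lb : {group coset_of M}) :
    M <| G -> chief_factor (G / M) Kb Lb ->
  exists K L : {group gT},
    [/\ chief_factor G K L, M \subset K, Kb :=: K / M & Lb :=: L / M].
Proof.
move=> nsMG /andP[maxKb nsLb]; have [/andP[ltKL nKb] maxKbX] := maxgroupP maxKb.
have nsKb : Kb <| G / M.
  by rewrite /normal nKb (subset_trans (proper_sub ltKL)) ?normal_sub.
have [L defL sML nsLG] := inv_quotientN nsMG nsLb.
have [K defK sMK nsKG] := inv_quotientN nsMG nsKb.
have nsM (X : {group gT}) : M \subset X -> X \subset G -> M <| X.
  by move=> sMX sXG; apply: normalS nsMG.
have nsMK := nsM K sMK (normal_sub nsKG); have nsML := nsM L sML (normal_sub nsLG).
exists K, L; split=> //; rewrite /chief_factor nsLG andbT.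
apply/maxgroupP; split.
  by rewrite (normal_norm nsKG) andbT -(quotient_proper nsMK nsML) -defK -defL.
move=> X /andP[ltXL nXG] sKX; have sMX := subset_trans sMK sKX.
have nsMX := nsM X sMX (subset_trans (proper_sub ltXL) (normal_sub nsLG)).
apply: (quotient_inj nsMX nsMK); rewrite -defK; apply: maxKbX.
  by rewrite defL quotient_proper // ltXL quotient_norms.
by rewrite defK quotientS.
Qed.

Lemma quotient_embedded G R H M :
    M <| G -> M \subset R -> H \subset G ->
  p_embedded p G R H -> p_embedded p (G / M) (R / M) (H / M).
Proof.
move=> nsMG sMR sHG [I [sHRI sIH embI]]; have nMG := normal_norm nsMG.
exists (I / M)%G; split; first by rewrite -quotientIG // quotientS.
  exact: quotientS.
move=> Kb Lb /(chief_factor_quotient nsMG)[K [L [chiefKL sMK defKb defLb]]].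
have [maxK nsLG] := andP chiefKL; have sKL := maxnormal_sub maxK.
have sLG := normal_sub nsLG.
have sMX : M \subset K <*> (I :&: L) by rewrite (subset_trans sMK) ?joing_subl.
have sXG : K <*> (I :&: L) \subset G.
  by rewrite join_subG (subset_trans sKL) //= subIset // sLG orbT.
have -> : Kb <*> (I / M :&: Lb) = (K <*> (I :&: L)) / M.
  rewrite defKb defLb -quotientIG ?(subset_trans sMK) //.
  by rewrite quotientY ?(subset_trans _ nMG) ?(subset_trans sKL) // subIset // sLG orbT.
rewrite -quotient_subnormG ?(normalS sMX sXG) // index_quotient_eq ?subsetIl //.
  exact: embI.
by rewrite subsetI subsetIl (subset_trans (subsetIr _ _)) // (subset_trans sMX) ?normG.
Qed.

End Embedding.

(** * Auxiliary results on p-groups and supplements *)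

Lemma p_subgroup_between (gT : finGroupType) (p n : nat) (P X : {group gT}) :
    prime p -> p.-group P -> X \subset P -> #|X| <= p ^ n -> p ^ n <= #|P| ->
  exists H : {group gT}, [/\ X \subset H, H \subset P & #|H| = (p ^ n)%N].
Proof.
move=> p_pr; have [k] := ubnP #|P|; elim: k => // k IHk in P *.
rewrite ltnS => lePk pP sXP leXn lenP.
have [eqP | neqP] := eqVneq #|P| (p ^ n)%N; first by exists P.
have [defX | [M maxM sXM]] := maximal_exists sXP.
  by case/eqP: neqP; apply/eqP; rewrite eqn_leq lenP andbT -defX.
have sMP := maxgroupp maxM; have /proper_sub sMP' := sMP.
have iMP := p_maximal_index pP maxM.
have leM : p ^ n <= #|M|.
  have cardP := card_pgroup pP; have := Lagrange sMP'; rewrite iMP cardP.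
  have lt_n : n < logn p #|P|.
    by rewrite -(ltn_exp2l _ _ (prime_gt1 p_pr)) -cardP ltn_neqAle eq_sym neqP.
  rewrite -(prednK (leq_ltn_trans (leq0n n) lt_n)) expnSr => /eqP.
  rewrite eqn_pmul2r ?prime_gt0 // => /eqP->.
  by rewrite leq_exp2l ?prime_gt1 // -ltnS (prednK (leq_ltn_trans (leq0n n) lt_n)).
have ltMk := leq_trans (proper_card sMP) lePk.
have [H [sXH sHM oH]] := IHk M ltMk (pgroupS sMP' pP) sXM leXn leM.
by exists H; rewrite (subset_trans sHM).
Qed.

(** By the three subgroups lemma 'Phi(W) is central in W, so W has class at
    most two. For w in W and a in A, the power w ^+ p is in 'Phi(W) and fixed
    by a, so [~ w, a] has order dividing p. Hence W is generated by elements of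
    order p, and in class two with p odd these form a group of exponent p. *)
Lemma exponent_self_commutator (gT : finGroupType) (p : nat) (W A : {group gT}) :
    odd p -> prime p -> p.-group W -> A \subset 'N(W) -> A \subset 'C('Phi(W)) ->
    [~: W, A] = W ->
  exponent W %| p.
Proof.
move=> p_odd p_pr pW nWA cPhiA defW.
have sPhiW := Phi_sub W; have nsPhi := Phi_normal W.
have cWPhi : [~: W, 'Phi(W)] = 1.
  rewrite -{1}defW; apply: three_subgroup.
    by rewrite (commG1P cPhiA) comm1G.
  apply/commG1P; apply: (@subset_trans _ _ 'Phi(W)); last by rewrite centsC.
  by rewrite commg_subl normal_norm.
have PhiX w : w \in W -> w ^+ p \in 'Phi(W).
  move=> Ww; rewrite (Phi_joing pW) mem_gen // inE; apply/orP; right.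
  by rewrite -[p]expn1 Mho_p_elt ?(mem_p_elt pW).
have sW'Phi : W^`(1) \subset 'Phi(W) by rewrite (Phi_joing pW) joing_subl.
have cPhiW : 'Phi(W) \subset 'C(W) by rewrite centsC; apply/commG1P.
have cWW x y z : x \in W -> y \in W -> z \in W -> commute z [~ x, y].
  move=> Wx Wy Wz; apply: commute_sym; apply: (centsP cPhiW) => //.
  by rewrite (subsetP sW'Phi) ?mem_commg.
have class2 : nil_class W <= 2.
  by rewrite nil_class2 subsetI der_sub (subset_trans sW'Phi).
suffices ->: W :=: 'Ohm_1(W) by apply: exponent_Ohm1_class2.
apply/eqP; rewrite eqEsubset Ohm_sub andbT -{1}defW gen_subG.
apply/subsetP=> _ /imset2P[w a Ww Aa ->]; rewrite /= (OhmE 1 pW) expn1 mem_gen //.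
have Wwa : w ^ a \in W by rewrite memJ_norm ?(subsetP nWA).
apply/LdivP; split; first by rewrite commgEl groupM ?groupV.
rewrite commgEl expMg_Rmul; try by apply: cWW; rewrite ?groupV.
rewrite expgVn -conjXg (_ : w ^+ p ^ a = w ^+ p) ?mulVg ?mul1g; last first.
  apply/conjg_fixP/commgP/commute_sym; apply: (centsP cPhiA) => //.
  exact: PhiX.
rewrite (bin2odd p_odd) expgM -commXg; last by apply: cWW; rewrite ?groupV.
rewrite (_ : [~ _, _] = 1) ?expg1n //; apply/eqP/commgP.
by apply: (centsP cPhiW); rewrite ?PhiX ?groupV.
Qed.

(** If u = h * n ^ u with h in H and n in N, then u = n * h, so N :^ u is
    N :^ h. *)
Lemma supplement_conj (gT : finGroupType) (G H N : {group gT}) u :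
  u \in G -> H \subset G -> H * N :^ u = G -> H * N = G.
Proof.
move=> Gu sHG defG; have := Gu; rewrite -{1}defG.
case/mulsgP=> h _ Hh /imsetP[n Nn ->] def_u.
have defu : u = n * h.
  have E: h * u^-1 * n = 1.
    by apply: (mulIg u); rewrite mul1g [RHS]def_u conjgE !mulgA.
  apply: invg_inj; rewrite invMg; apply: (mulgI h); apply: (mulIg n).
  by rewrite E mulKVg mulVg.
apply: (@conjsg_inj _ h); rewrite (conjGid (subsetP sHG h Hh)) conjsMg (conjGid Hh).
by rewrite -[RHS]defG defu conjsgM (conjGid Nn).
Qed.

(** M / X is the only subgroup of order p of P / X, and a p-group of odd order
    with this property is cyclic. *)
Lemma cyclic_unique_over (gT : finGroupType) (p : nat) (P X M : {group gT}) :
    prime p -> odd p -> p.-group P -> X <| P -> X \subset M -> M \subset P ->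
    #|M| = (p * #|X|)%N ->
    (forall H : {group gT}, X \subset H -> H \subset P -> #|H| = #|M| -> H :=: M) ->
  cyclic (P / X).
Proof.
move=> p_pr p_odd pP nsXP sXM sMP oM uniqM; have nXP := normal_norm nsXP.
have pPX := quotient_pgroup X pP.
rewrite (odd_pgroup_rank1_cyclic pPX) ?(odd_pgroup_odd p_odd) // leqNgt.
apply/negP=> /p_rank_geP[E /pnElemP[sEPX abelE dimE]].
have nXM := subset_trans sMP nXP.
have oMX : #|M / X| = p.
  by rewrite card_quotient // -(divgS sXM) oM mulnK ?cardG_gt0.
have [_ _ expE] := and3P abelE.
have /subsetPn[e Ee notMe] : ~~ (E \subset M / X).
  apply/negP=> /subset_leq_card; rewrite oMX.
  rewrite (card_pgroup (abelem_pgroup abelE)) dimE leqNgt -{1}(expn1 p).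
  by rewrite ltn_exp2l ?prime_gt1.
have nte : e != 1 by apply: contraNneq notMe => ->.
have oe : #[e] = p by apply: (abelem_order_p abelE).
have seP : <[e]> \subset P / X by rewrite cycle_subG (subsetP sEPX).
have [H defH sXH sHP] := inv_quotientS nsXP seP.
have nXH := subset_trans sHP nXP.
case/negP: notMe; rewrite -(uniqM H) //; first by rewrite -defH cycle_id.
by rewrite -(Lagrange sXH) -card_quotient // -defH -orderE oe oM mulnC.
Qed.

(** * The minimal configuration *)

Section Reduction.

Variables (gT : finGroupType) (p m : nat) (G P0 P R Y K Q0 : {group gT}).
Implicit Types A B C D E H L M N X : {group gT}.
Hypotheses (p_pr : prime p) (p_odd : odd p).
Hypothesis sylP0 : p.-Sylow(G) P0.
Hypotheses (nsPP0 : P <| P0) (nsRG : R <| G) (pGR : p.-group (G / R)).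
Hypothesis sPRP : P0 :&: R \subset P.
Hypothesis ltmP : p ^ m < #|P|.
Hypothesis hypH : forall H, H \subset P -> #|H| = (p ^ m)%N ->
  pnil_supplemented p G H \/ p_embedded p G R H.
Hypotheses (sYG : Y \subset G) (minY : min_nonpnil p Y P0).
Hypothesis hallK : p^'.-Hall(Y) K.
Hypotheses (maxQ0 : maximal Q0 P0) (sSQ0 : 'N_P0(K) \subset Q0).

Local Notation O := 'O_p(Y).
Local Notation S0 := 'N_P0(K).
Local Notation P1 := (P :&: Q0).

Let nilYO : pnil p (Y / O) := min_nonpnil_quotient p_pr p_odd minY.
Let sylP0Y : p.-Sylow(Y) P0. Proof. by case: minY. Qed.
Let sP0Y := pHall_sub sylP0Y.
Let pP0 := pHall_pgroup sylP0Y.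
Let sOP0 : O \subset P0 := pcore_sub_Hall sylP0Y.
Let nsOY : O <| Y := pcore_normal p Y.
Let pO : p.-group O := pcore_pgroup p Y.
Let sKY := pHall_sub hallK.
Let p'K := pHall_pgroup hallK.
Let nOK : K \subset 'N(O) := subset_trans sKY (normal_norm nsOY).
Let coOK : coprime #|O| #|K| := pnat_coprime pO p'K.
Let sPP0 := normal_sub nsPP0.
Let ltQ0P0 : Q0 \proper P0 := maxgroupp maxQ0.
Let sQ0P0 := proper_sub ltQ0P0.
Let nsQ0 := p_maximal_normal pP0 maxQ0.
Let iQ0 := p_maximal_index pP0 maxQ0.
Let pP := pgroupS sPP0 pP0.

Lemma card_setI_max A : A \subset P0 -> p ^ m < #|A| -> p ^ m <= #|A :&: Q0|.
Proof.
move=> sAP0 ltmA; have pA := pgroupS sAP0 pP0.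
have leA : #|A| <= p * #|A :&: Q0|.
  rewrite -(leq_pmul2r (cardG_gt0 Q0)) mul_cardG -mulnA [(#|A :&: _| * _)%N]mulnC mulnA.
  rewrite leq_mul2r -iQ0 mulnC Lagrange //.
  by rewrite (subset_leq_card (mul_subG sAP0 sQ0P0)) orbT.
have lt_m : m < logn p #|A|.
  by rewrite -(ltn_exp2l _ _ (prime_gt1 p_pr)) -card_pgroup.
rewrite -(leq_pmul2l (prime_gt0 p_pr)) -expnS.
by apply: leq_trans leA; rewrite (card_pgroup pA) leq_exp2l ?prime_gt1.
Qed.

Lemma card_P1 : p ^ m <= #|P1|.
Proof. exact: card_setI_max sPP0 ltmP. Qed.

Lemma P1_subgroup X : X \subset P1 -> #|X| <= p ^ m ->
  exists H, [/\ X \subset H, H \subset P1 & #|H| = (p ^ m)%N].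
Proof.
move=> sXP1 leX; apply: (p_subgroup_between p_pr _ sXP1 leX card_P1).
by rewrite (pgroupS _ pP) ?subsetIl.
Qed.

(** T :&: Y supplements the p-group H in Y, so its normal p-complement is a
    Hall p'-subgroup of Y, conjugate to K. Hence a conjugate of 'N_Y(K)
    supplements H in Y, and then so does 'N_Y(K) itself. *)
Lemma supplement_Hall_norm H :
  H \subset P0 -> pnil_supplemented p G H -> H * S0 = P0.
Proof.
move=> sHP0 [T [sTG defG nilT]]; have sHY := subset_trans sHP0 sP0Y.
pose X := (T :&: Y)%G.
have defY : H * X = Y by rewrite group_modl // defG (setIidPr sYG).
have nilX : pnil p X by apply: pnilS nilT; apply: subsetIl.
pose L := 'O_p^'(X)%G.
have sXY : X \subset Y := subsetIr _ _.
have hallL : p^'.-Hall(Y) L.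
  rewrite pHallE (subset_trans (pcore_sub _ _) sXY) /= (card_Hall nilX).
  rewrite -(Lagrange sXY) partnM // [X in _ == (_ * X)%N]part_p'nat ?muln1 //.
  rewrite pnatNK; apply: (@pnat_dvd _ #|H|); last exact: pgroupS sHP0 pP0.
  rewrite -(dvdn_pmul2l (cardG_gt0 X)) Lagrange // -[in X in X %| _]defY mulnC.
  by rewrite mul_cardG dvdn_mulr.
have [u Ou defL] := min_Hall_conj nilYO hallK hallL.
have Yu := subsetP (normal_sub nsOY) u Ou.
have sXN : X \subset 'N_Y(K) :^ u.
  rewrite conjIg (conjGid Yu) -normJ -defL subsetI sXY.
  exact: normal_norm (pcore_normal _ _).
have defYN : H * 'N_Y(K) = Y.
  apply: (supplement_conj Yu sHY); apply/eqP; rewrite eqEsubset.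
  have sNuY : 'N_Y(K) :^ u \subset Y.
    by rewrite conjIg (conjGid Yu) subsetIl.
  by rewrite mul_subG //=; have := mulgS H sXN; rewrite defY.
rewrite -{2}(setIidPr sP0Y) -{1}defYN -group_modl // setIAC.
by rewrite (setIidPr sP0Y).
Qed.

Lemma P1_embedded H : H \subset P1 -> #|H| = (p ^ m)%N -> p_embedded p G R H.
Proof.
rewrite subsetI => /andP[sHP sHQ0] oH; case: (hypH sHP oH) => // suppH.
have defP0 := supplement_Hall_norm (subset_trans sHP sPP0) suppH.
have: P0 \subset Q0 by rewrite -defP0 mul_subG.
by rewrite (negPf (proper_subn ltQ0P0)).
Qed.

Lemma commP0_sub_max A : A \subset P0 -> [~: A, P0] \subset Q0.
Proof.
move=> sAP0; apply: subset_trans (commSg P0 sAP0) _.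
apply: der1_min; first exact: normal_norm nsQ0.
by apply/cyclic_abelian/prime_cyclic; rewrite card_quotient ?normal_norm // iQ0.
Qed.

Lemma Hall_sub_residual : K \subset R.
Proof. exact: p'group_sub_pquo nsRG pGR (subset_trans sKY sYG) p'K. Qed.

(** W is a minimal Y-normal subgroup of O not centralised by K, so every
    Y-normal proper subgroup of W is centralised by K, and W has exponent p.
    Let M be maximal among the G-invariant proper subgroups of the normal
    closure L of W. As K does not centralise W modulo B = W :&: M, neither
    does P0 by [min_comm], and there is an x of order p in [~: W, P0] outside
    M. The embedding of <[x]> gives that L is contained in M <*> [~: W, P0],
    so [~: W, P0] covers W / B; but P0 / B is nilpotent. *)
Theorem embedded_order_p : m = 1%N -> False.
Proof.
move=> m1.
pose okW (W : {group gT}) := [&& W \subset O, W <| Y & ~~ (K \subset 'C(W))].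
have [W] : {W : {group gT} | mingroup W okW}.
  apply: ex_mingroup; exists 'O_p(Y)%G.
  by rewrite /okW subxx nsOY (min_Hall_not_cent minY nilYO hallK).
case/mingroupP=> /and3P[sWO nsWY not_cWK] minW.
have cBK (B : {group gT}) : B <| Y -> B \subset W -> B :!=: W -> K \subset 'C(B).
  move=> nsBY sBW; apply: contraR => not_cBK; apply/eqP/minW => //.
  by rewrite /okW nsBY not_cBK (subset_trans sBW).
have [sWY nWY] := andP nsWY; have pW := pgroupS sWO pO.
have nWK := subset_trans sKY nWY.
have comK (B : {group gT}) : B <| Y -> B \subset W -> [~: W, K] \subset B -> B :=: W.
  move=> nsBY sBW sWKB; apply/eqP; apply: contraR not_cWK => neqBW.
  apply: (coprime_comm_cent nWK); rewrite ?(pgroup_sol pW) //.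
    exact: coprimeSg coOK.
  by rewrite centsC (subset_trans (cBK B nsBY sBW neqBW)) ?centS.
have ntW : W :!=: 1.
  by apply: contraNneq not_cWK => W1; rewrite W1 cents1.
have nsPhi : 'Phi(W) <| Y := gFnormal_trans _ nsWY.
have cPhiK : K \subset 'C('Phi(W)).
  by rewrite cBK ?Phi_sub ?proper_neq ?Phi_proper.
pose CF := ('C_Y('Phi(W)))%G.
have nsCF : CF <| Y by rewrite /normal subsetIl normsI ?normG ?norms_cent ?normal_norm.
have sKCF : K \subset CF by rewrite subsetI sKY.
have nWCF : CF \subset 'N(W) := subset_trans (normal_sub nsCF) nWY.
have defW : [~: W, CF] = W.
  apply: comK; rewrite ?commgS ?commg_subl //.
  rewrite /normal (subset_trans _ sWY) ?commg_subl //.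
  by rewrite normsR // normal_norm.
have expW : exponent W %| p.
  by apply: exponent_self_commutator pW nWCF _ defW => //; apply: subsetIr.
have sWR : W \subset R.
  have nsRY : R :&: Y <| Y by rewrite setIC (normalGI sYG).
  have nsWR : W :&: R <| Y.
    have ->: W :&: R = W :&: (R :&: Y) by rewrite [R :&: Y]setIC setIA (setIidPl sWY).
    exact: normalI.
  rewrite -(comK (W :&: R)%G nsWR (subsetIl _ _)) ?subsetIr //.
  rewrite subsetI commg_subl nWK /= (subset_trans (commgS _ Hall_sub_residual)) //.
  by rewrite commg_subr (subset_trans (subset_trans sWY sYG)) ?normal_norm.
have sWP0 := subset_trans sWO sOP0.
have sWP : W \subset P by rewrite (subset_trans _ sPRP) // subsetI sWP0.
have sWG := subset_trans sWY sYG.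
pose L := <<class_support W G>>%G.
have nsLG : L <| G.
  rewrite /normal norms_gen ?class_support_norm // andbT gen_subG.
  by rewrite class_supportEr; apply/bigcupsP=> g Gg; rewrite -(conjGid Gg) conjSg.
have sWL : W \subset L by rewrite sub_gen ?sub_class_support.
have minL (N : {group gT}) : N <| G -> W \subset N -> L \subset N.
  move=> /andP[_ nNG] sWN; rewrite gen_subG class_supportEr.
  by apply/bigcupsP=> g Gg; rewrite -(normsP nNG g Gg) conjSg.
have ntL : L :!=: 1 by apply: subG1_contra ntW.
have [M maxM] : {M : {group gT} | maxnormal M L G}.
  by apply: ex_maxgroup; exists 1%G; rewrite norms1 properEneq eq_sym ntL sub1G.
have chiefML : chief_factor G M L by rewrite /chief_factor maxM.
have ltML := maxnormal_proper maxM.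
have nMG : G \subset 'N(M) by case/maxgroupP: maxM => /andP[].
have nsMG : M <| G by rewrite /normal nMG (subset_trans (proper_sub ltML)) ?normal_sub.
have not_sWM : ~~ (W \subset M).
  by apply: contraL ltML => /(minL M nsMG) sLM; rewrite properE sLM andbF.
pose B := (W :&: M)%G.
have nsBY : B <| Y.
  by rewrite /normal subIset ?sWY // normsI // (subset_trans sYG).
have neqBW : B :!=: W.
  by apply: contraNneq not_sWM => <-; apply: subsetIr.
have nWP0 := subset_trans sP0Y nWY.
have nMP0 := subset_trans sP0Y (subset_trans sYG nMG).
pose D := [~: W, P0]%G.
have sDW : D \subset W by rewrite commg_subl.
have [sDM | /subsetPn[x Dx notMx]] := boolP (D \subset M).
  case/eqP: neqBW; apply: comK => //; first exact: subsetIl.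
  apply: subset_trans (commgS _ sKY) _; apply: (min_comm minY) => //.
  by rewrite subsetI sDW.
have Wx := subsetP sDW x Dx.
have ntx : x != 1 by apply: contraNneq notMx => ->.
have ox : #[x] = p by apply: nt_prime_order => //; apply: (exponentP expW).
have sxP1 : <[x]> \subset P1.
  by rewrite cycle_subG inE (subsetP sWP) // (subsetP (commP0_sub_max sWP0)).
have embx : p_embedded p G R <[x]>%G.
  by apply: P1_embedded; rewrite // m1 expn1.
have sxP0 : <[x]> \subset P0 by rewrite cycle_subG (subsetP sWP0).
have sLMD : L \subset M <*> D.
  apply: (p_embedded_chief sylP0 sxP0 embx chiefML).
  - apply: contra notMx => /subsetP; apply.
    by rewrite !inE cycle_id (subsetP sWL) // (subsetP sWR).
  - by rewrite normsY // commg_normr.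
  - exact: joing_subl.
  by rewrite subIset // cycle_subG (subsetP (joing_subr _ _)).
have nMD : D \subset 'N(M).
  by rewrite (subset_trans sDW) // (subset_trans sWP0).
have defWD : D * B = W.
  rewrite /= setIC group_modl // (normC nMD) -norm_joinEr //; apply/setIidPr.
  exact: subset_trans sWL sLMD.
case/eqP: neqBW; apply/eqP; rewrite eqEsubset subsetIl /=.
have nBP0 := subset_trans sP0Y (normal_norm nsBY).
have nBW := subset_trans sWP0 nBP0.
rewrite -quotient_sub1 // subG1; apply: contraT => ntWB.
have := nil_comm_properl (quotient_nil B (pgroup_nil pP0)) (quotientS B sWP0) ntWB.
move/(_ (P0 / B)); rewrite subsetI subxx quotient_norms // => /(_ isT).
have eDB : [~: W, P0] / B = W / B by rewrite -quotientMidr defWD.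
by rewrite -quotientR // eDB properxx.
Qed.

(** The p-group P0 centralises the section A / B of order p, so Y does. *)
Lemma chief_order_p A B :
    A <| Y -> B <| Y -> A \subset O -> B \subset A -> #|A : B| = p ->
  [~: A, K] \subset B.
Proof.
move=> nsAY nsBY sAO sBA iAB; have sAP0 := subset_trans sAO sOP0.
have nBP0 := subset_trans sP0Y (normal_norm nsBY).
have nBA := subset_trans sAP0 nBP0.
apply: subset_trans (commgS _ sKY) _; apply: (min_comm minY) => //.
have oAB : #|A / B| = p by rewrite card_quotient.
have ntAB : A / B != 1 by rewrite -cardG_gt1 oAB prime_gt1.
have := nil_comm_properl (quotient_nil B (pgroup_nil pP0)) (quotientS B sAP0) ntAB.
move/(_ (P0 / B)); rewrite subsetI subxx quotient_norms ?(subset_trans sP0Y) ?normal_norm //.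
move/(_ isT)/proper_card; rewrite oAB => lt_p.
rewrite -quotient_sub1 ?comm_subG // quotientR //.
have /primeP[_ dvp] := p_pr.
have : #|[~: A / B, P0 / B]| %| p.
  rewrite -oAB cardSg // commg_subl quotient_norms //.
  exact: subset_trans sP0Y (normal_norm nsAY).
case/dvp/orP => /eqP oC; last by rewrite oC ltnn in lt_p.
by rewrite (card1_trivg oC).
Qed.

(** K would centralise A / B by [chief_order_p], so that A would be the product
    of [~: A, K] and 'C_A(K), both contained in B. *)
Lemma index_over_cent_neq A B :
    A <| Y -> A \subset O -> 'C_A(K) \subset B -> B <| Y -> B \subset A ->
  #|A : B| != p.
Proof.
move=> nsAY sAO sCB nsBY sBA; apply/eqP=> iAB.
have sAKB := chief_order_p nsAY nsBY sAO sBA iAB.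
have nAK := subset_trans sKY (normal_norm nsAY).
have defA: [~: A, K] * 'C_A(K) = A.
  by apply: coprime_comm_cent_prod; rewrite ?(coprimeSg sAO) ?(pgroup_sol (pgroupS sAO pO)).
have sAB : A \subset B by rewrite -defA mul_subG.
have defB : A :=: B by apply/eqP; rewrite eqEsubset sAB.
by move: (prime_gt1 p_pr); rewrite -iAB defB indexgg.
Qed.

Section ChiefM.

Variable M : {group gT}.
Hypotheses (chiefM : chief_factor G 1 M) (sMR : M \subset R) (m_gt0 : 0 < m).

Let nsMG : M <| G. Proof. by case/andP: chiefM. Qed.
Let sMG := normal_sub nsMG.
Let nMP0 : P0 \subset 'N(M) := subset_trans (pHall_sub sylP0) (normal_norm nsMG).
Let sMP0P : P0 :&: M \subset P := subset_trans (setIS P0 sMR) sPRP.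

Lemma embedded_minimal H (Q : {group gT}) :
    H \subset P0 -> p_embedded p G R H -> H :&: M != 1 -> P0 \subset 'N(Q) ->
  H :&: M \subset Q -> M \subset Q.
Proof.
move=> sHP0 embH ntHM nQP0.
apply: (p_embedded_chief sylP0 sHP0 embH chiefM _ nQP0 (sub1G Q)).
by rewrite -setIA (setIidPl sMR) subG1.
Qed.

(** Otherwise the Sylow subgroup Z of M contained in P0 meets Q0 trivially, so
    it has order p, and it is in fact normal in Y. Then it is centralised by
    K, so it is contained in 'N_P0(K) and in Q0. *)
Lemma P1_meets : ~~ p^'.-group M -> P1 :&: M != 1.
Proof.
move=> not_p'M; apply/negP=> /eqP P1M.
pose Z := (M :&: P0)%G; have sylZ : p.-Sylow(M) Z := Sylow_setI_normal nsMG sylP0.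
have pZ := pHall_pgroup sylZ.
have ntZ : Z :!=: 1.
  apply: contra not_p'M => /eqP Z1.
  by rewrite -partG_eq1 -(card_Hall sylZ) Z1 cards1.
have sZP0 : Z \subset P0 := subsetIr _ _.
have sZP : Z \subset P by rewrite (subset_trans _ sMP0P) // setIC.
have ZQ0 : Z :&: Q0 = 1.
  by apply/trivgP; rewrite -P1M subsetI setSI //= -setIA subsetIl.
have oZ : #|Z| = p.
  have leZ : #|Z| <= p.
    rewrite -(leq_pmul2r (cardG_gt0 Q0)) -TI_cardMg // -iQ0 mulnC Lagrange //.
    by rewrite subset_leq_card // mul_subG.
  have [_ pdvZ _] := pgroup_pdiv pZ ntZ.
  by apply/eqP; rewrite eqn_leq leZ dvdn_leq.
have nsMY : Y :&: M <| Y by rewrite (normalGI sYG).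
have sZMY : Z \subset P0 :&: (Y :&: M).
  by rewrite subsetI sZP0 subsetI (subset_trans sZP0) ?subsetIl.
have sZO : Z \subset O.
  have prZ : prime #|Z| by rewrite oZ.
  have [//|ZO1] := prime_subgroupVti 'O_p(Y)%G prZ.
  have cMYO : Y :&: M \subset 'C(O).
    rewrite centsC; apply/commG1P/trivgP; rewrite -ZO1 !subsetI.
    rewrite commg_subl (subset_trans (normal_sub nsMY)) ?normal_norm //=.
    rewrite (subset_trans _ (subsetIr Y M)) ?commg_subr ?(subset_trans (normal_sub nsOY)) ?normal_norm //=.
    rewrite (subset_trans _ sOP0) // commg_subl.
    by rewrite (subset_trans (normal_sub nsMY)) ?normal_norm.
  have nilMY := min_cent_pnil minY nilYO hallK nsMY cMYO.
  exact: subset_trans sZMY (min_pnil_pcore minY nsMY nilMY).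
have defZ : Z :=: O :&: (Y :&: M).
  apply/eqP; rewrite eqEsubset subsetI sZO (subset_trans sZMY) ?subsetIr //=.
  by rewrite subsetI (subset_trans (subsetIl _ _) sOP0) setIA subsetIr.
have nsZY : Z <| Y by rewrite defZ normalI.
have cZK : [~: Z, K] \subset [1 gT].
  apply: chief_order_p; rewrite ?normal1 ?sub1G //.
  by rewrite indexg1.
case/eqP: ntZ; apply/trivgP; rewrite -ZQ0 subsetI subxx.
apply: subset_trans sSQ0; rewrite subsetI sZP0.
apply: subset_trans (cent_sub K).
by apply/commG1P/trivgP.
Qed.

Hypothesis not_p'M : ~~ p^'.-group M.

(** An element of order p of P1 :&: M lies in an embedded subgroup H of P1,
    and P0 :&: M is a P0-invariant subgroup containing H :&: M. *)
Lemma minimal_sub_Sylow : M \subset P0.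
Proof.
have p_dv : p %| #|P1 :&: M|.
  have pP1M: p.-group (P1 :&: M) by apply: pgroupS pP; rewrite subIset // subsetIl.
  by have [] := pgroup_pdiv pP1M (P1_meets not_p'M).
have [x /setIP[P1x Mx] ox] := Cauchy p_pr p_dv.
have [||H [sxH sHP1 oH]] := @P1_subgroup <[x]>%G; rewrite ?cycle_subG //.
  by rewrite -orderE ox -{1}(expn1 p) leq_exp2l ?prime_gt1.
have sHP0 : H \subset P0 by rewrite (subset_trans sHP1) // subIset ?sPP0.
suffices: M \subset P0 :&: M by rewrite subsetI => /andP[].
apply: (embedded_minimal sHP0 (P1_embedded sHP1 oH)).
- apply: (@subG1_contra _ <[x]>); first by rewrite subsetI sxH cycle_subG.
  by rewrite -cardG_gt1 -orderE ox prime_gt1.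
- by rewrite normsI ?normG.
exact: setSI.
Qed.

Let sMP0 := minimal_sub_Sylow.
Let sMP : M \subset P. Proof. by rewrite (subset_trans _ sMP0P) // subsetI sMP0 subxx. Qed.
Let pM : p.-group M := pgroupS sMP0 pP0.
Let nsMP0 : M <| P0. Proof. by rewrite /normal sMP0. Qed.
Let nsMY : M <| Y := normalS (subset_trans sMP0 sP0Y) sYG nsMG.
Let sMO : M \subset O := pcore_max pM nsMY.
Let ltpm : 1 < p ^ m. Proof. by rewrite -(exp1n m) ltn_exp2r ?prime_gt1. Qed.

(** If M were larger, M :&: Q0 would have a P0-invariant subgroup of order
    p ^ m; it would be embedded, and so would contain M. *)
Lemma card_minimal : #|M| <= p ^ m.
Proof.
rewrite leqNgt; apply/negP=> ltmM.
have lem := card_setI_max sMP0 ltmM.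
have nsMQ : M :&: Q0 <| P0 by rewrite normalI.
have pMQ := pgroupS (subset_trans (subsetIl M Q0) sMP0) pP0.
have ler : m <= logn p #|M :&: Q0|.
  by rewrite -(leq_exp2l _ _ (prime_gt1 p_pr)) -card_pgroup.
have [X [sXM nsXP0 oX]] := normal_pgroup pP0 nsMQ ler.
have sXP1 : X \subset P1 by rewrite (subset_trans sXM) ?setSI.
have sXM' : X \subset M by rewrite (subset_trans sXM) ?subsetIl.
have sMX : M \subset X.
  apply: (embedded_minimal (normal_sub nsXP0) (P1_embedded sXP1 oX)).
  - by rewrite (setIidPl sXM') -cardG_gt1 oX.
  - exact: normal_norm.
  exact: subsetIl.
by have := subset_leq_card sMX; rewrite oX leqNgt ltmM.
Qed.

(** An embedded subgroup of order p ^ m of P1 that contains M :&: Q0 has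
    exactly this intersection with M, and M :&: Q0 is P0-invariant, so M is
    contained in Q0, as is 'N_P0(K). *)
Lemma minimal_not_supplement : M * S0 != P0.
Proof.
apply/eqP=> defP0.
have notMQ : ~~ (M \subset Q0).
  apply: contra (proper_subn ltQ0P0) => sMQ0; rewrite -defP0 mul_subG //.
have P1M : P1 :&: M = M :&: Q0 by rewrite setIAC (setIidPr sMP).
have [||H [sXH sHP1 oH]] := @P1_subgroup (M :&: Q0)%G.
- by rewrite setSI.
- by rewrite (leq_trans _ card_minimal) // subset_leq_card ?subsetIl.
case/negP: notMQ; suffices: M \subset M :&: Q0 by rewrite subsetI => /andP[].
have sHP0 : H \subset P0 by rewrite (subset_trans sHP1) // subIset ?sPP0.
apply: (embedded_minimal sHP0 (P1_embedded sHP1 oH)).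
- apply: (@subG1_contra _ (M :&: Q0)); first by rewrite subsetI sXH subsetIl.
  by have := P1_meets not_p'M; rewrite P1M.
- by rewrite normsI // normal_norm.
by rewrite /= -P1M setSI.
Qed.

(** O is the product of [~: O, K] and 'C_O(K), and P0 = O * 'N_P0(K), so the
    hypothesis gives P0 = M * 'N_P0(K). *)
Lemma minimal_comm_contra : [~: O, K] \subset M * S0 -> False.
Proof.
move=> sOKM; case/eqP: minimal_not_supplement; apply/eqP.
have gMS : M * S0 = M <*> S0 by rewrite norm_joinEr // (subset_trans (subsetIl P0 _)).
rewrite gMS in sOKM *; rewrite eqEsubset join_subG sMP0 subsetIl /=.
rewrite -{1}(min_Sylow_Frattini minY nilYO hallK) mul_subG ?joing_subr //.
rewrite -(min_pcore_prod hallK) mul_subG //.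
exact: subset_trans (min_cent_norm minY K) (joing_subr _ _).
Qed.

Lemma minimal_quotient_contra : pnil p (G / M) -> False.
Proof.
move=> nilGM; apply: minimal_comm_contra.
apply: subset_trans (mulG_subl _ _).
have nMY := normal_norm nsMY.
have nilYM : pnil p (Y / M) by apply: pnilS nilGM; apply: quotientS.
have nMO := subset_trans (normal_sub nsOY) nMY.
rewrite -quotient_cents2 ?(subset_trans sKY) // centsC.
apply: subset_trans (norm_p'core_cent (quotient_normal M nsOY) (quotient_pgroup M pO)).
by rewrite (sub_Hall_pcore nilYM) ?quotientS // quotient_pgroup.
Qed.

(** Let X have index p in M and be normal in P0, and put A = O :&: R, a
    Y-normal subgroup that contains [~: O, K]. Suppose that P has a subgroup H
    of order p ^ m containing X and different from M, so that H :&: M = X. An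
    embedded H would give that M is contained in X. A supplemented H gives
    that M * 'N_P0(K) has index at most p in P0, so that B = M * 'C_A(K), which
    is not A by [minimal_comm_contra], is a Y-normal subgroup of index p of A,
    contrary to [index_over_cent_neq]. If
    there is no such H then P / X is cyclic, and so is A / M; a maximal
    subgroup of A containing B is thus normal in Y, with the same
    contradiction. *)
Lemma card_minimal_neq : 1 < m -> #|M| != (p ^ m)%N.
Proof.
move=> m_gt1; apply/eqP=> oM.
have [X [sXM nsXP0 oX]] : exists X : {group gT},
    [/\ X \subset M, X <| P0 & #|X| = (p ^ m.-1)%N].
  apply: normal_pgroup pP0 nsMP0 _.
  by rewrite oM pfactorK // leq_pred.
have ntX : X :!=: 1 by rewrite -cardG_gt1 oX -(exp1n m.-1) ltn_exp2r ?prime_gt1 // -ltnS prednK.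
have oMX : #|M| = (p * #|X|)%N by rewrite oM oX -expnS prednK.
have nXP0 := normal_norm nsXP0.
have not_sMX : ~~ (M \subset X).
  apply/negP=> /subset_leq_card; rewrite oMX leqNgt.
  by rewrite -{1}[#|X|]mul1n ltn_pmul2r ?cardG_gt0 // prime_gt1.
pose A := ('O_p(Y) :&: R)%G.
have nsAY : A <| Y.
  have -> : A :=: O :&: (Y :&: R) by rewrite /= setIA (setIidPl (normal_sub nsOY)).
  by rewrite normalI // (normalGI sYG).
have sAO : A \subset O := subsetIl _ _.
have sMA : M \subset A by rewrite subsetI sMO.
have nAK := subset_trans sKY (normal_norm nsAY).
have sOKA : [~: O, K] \subset A.
  rewrite subsetI commg_subl nOK /= (subset_trans (commgS _ Hall_sub_residual)) //.
  by rewrite commg_subr (subset_trans (normal_sub nsOY)) // (subset_trans sYG) ?normal_norm.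
have sAP0 := subset_trans sAO sOP0.
have sAP : A \subset P by rewrite (subset_trans _ sPRP) // setSI.
have nMS0 : S0 \subset 'N(M) by rewrite (subset_trans (subsetIl P0 _)).
have nMK : K \subset 'N(M) := subset_trans sKY (normal_norm nsMY).
have sCS0 : 'C_A(K) \subset S0.
  by apply: subset_trans (min_cent_norm minY K); rewrite setSI.
have nMC : 'C_A(K) \subset 'N(M) := subset_trans sCS0 nMS0.
pose B := (M <*> 'C_A(K))%G.
have defB : B :=: M * 'C_A(K) by rewrite /= norm_joinEr.
have sBA : B \subset A by rewrite join_subG sMA subsetIl.
have sCB : 'C_A(K) \subset B := joing_subr _ _.
have [eqBA | ltBA] := eqVproper sBA.
  apply: minimal_comm_contra; apply: subset_trans sOKA _.
  by rewrite -eqBA defB mulgS.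
have pA := pgroupS sAO pO.
have coAK : coprime #|A| #|K| := coprimeSg sAO coOK.
have [/existsP[H /and4P[sXH sHP /eqP oH neqHM]] | ] :=
    boolP [exists H : {group gT}, [&& X \subset H, H \subset P, #|H| == (p ^ m)%N & H != M]].
  have sHP0 := subset_trans sHP sPP0.
  have sHMX : H :&: M \subset X.
    have sXHM : X \subset H :&: M by rewrite subsetI sXH.
    have pHM := pgroupS (subsetIr H M) pM.
    have ltHM : #|H :&: M| < p ^ m.
      rewrite -oM proper_card // properE subsetIr /=.
      apply: contra neqHM; rewrite subsetI subxx andbT => sMH.
      by rewrite eq_sym -val_eqE eqEcard sMH oM oH /=.
    suffices: #|H :&: M| <= #|X|.
      by move=> leX; have/eqP<-: X == (H :&: M)%G :> {set gT} by rewrite eqEcard sXHM.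
    rewrite oX (card_pgroup pHM) leq_exp2l ?prime_gt1 //.
    rewrite (card_pgroup pHM) ltn_exp2l ?prime_gt1 // in ltHM.
    by rewrite -ltnS prednK.
  case: (hypH sHP oH) => [suppH | embH]; last first.
    case/negP: not_sMX; apply: (embedded_minimal sHP0 embH) => //.
    by apply: subG1_contra ntX; rewrite subsetI sXH.
  have defP0 := supplement_Hall_norm sHP0 suppH.
  pose N := (M <*> S0)%G; have defN : N :=: M * S0 by rewrite /= norm_joinEr.
  have sNP0 : N \subset P0 by rewrite join_subG sMP0 subsetIl.
  have leN : #|P0| <= p * #|N|.
    have defHN : H * N = P0.
      apply/eqP; rewrite eqEsubset mul_subG //= -{1}defP0 mulgS //.
      exact: joing_subr.
    have sXN : X \subset H :&: N by rewrite subsetI sXH (subset_trans sXM) ?joing_subl.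
    rewrite -(leq_pmul2r (cardG_gt0 X)) -{1}defHN.
    apply: leq_trans (_ : #|(H * N)%g| * #|H :&: N| <= _).
      by rewrite leq_mul2l subset_leq_card ?orbT.
    by rewrite -mul_cardG oH -oM oMX mulnAC.
  have defAN : A * N = P0.
    apply/eqP; rewrite eqEsubset mul_subG //=.
    apply: (@subset_trans _ _ ([~: O, K] * ('C_O(K) * S0))).
      by rewrite mulgA (min_pcore_prod hallK) (min_Sylow_Frattini minY nilYO hallK).
    apply: mulgSS => //; rewrite mul_subG ?joing_subr //.
    exact: subset_trans (min_cent_norm minY K) (joing_subr _ _).
  have AS0 : A :&: S0 = 'C_A(K).
    rewrite setIA (setIidPl sAP0) coprime_norm_cent //.
  have AN : A :&: N = B.
    by rewrite defB -AS0 setIC defN -group_modl // setIC.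
  have iAB : #|A : B| = p.
    have le_p : #|A : B| <= p.
      rewrite -(leq_pmul2l (cardG_gt0 B)) Lagrange //.
      rewrite -(leq_pmul2r (cardG_gt0 N)) mul_cardG defAN AN.
      by rewrite mulnC -mulnA leq_mul2l leN orbT.
    have pAB : p.-nat #|A : B| := pnat_dvd (dvdn_indexg A B) pA.
    have iAB_gt1 : 1 < #|A : B| by rewrite indexg_gt1 proper_subn.
    apply/eqP; rewrite eqn_leq le_p /=.
    have [[|k] oAB] := p_natP pAB; first by rewrite oAB in iAB_gt1.
    by rewrite oAB expnS leq_pmulr // expn_gt0 prime_gt0.
  have nsBA : B <| A.
    apply: (p_maximal_normal pA); apply: p_index_maximal => //.
    by rewrite iAB.
  suffices nsBY : B <| Y.
    by have := index_over_cent_neq nsAY sAO sCB nsBY sBA; rewrite iAB eqxx.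
  rewrite /normal (subset_trans sBA (normal_sub nsAY)) /=.
  rewrite -{1}(min_mulKP minY hallK) -defAN defN.
  have nBS0 : S0 \subset 'N(B).
    rewrite normsY // normsI ?norms_cent ?subsetIr //.
    exact: subset_trans (subsetIl _ _) (subset_trans sP0Y (normal_norm nsAY)).
  have nBK : K \subset 'N(B).
    by rewrite normsY // cents_norm // centsC subsetIr.
  rewrite !mul_subG ?(normal_norm nsBA) //.
  exact: subset_trans (joing_subl _ _) (normG B).
rewrite negb_exists => /forallP noH.
have cycPX : cyclic (P / X).
  apply: (cyclic_unique_over p_pr p_odd pP (normalS (subset_trans sXM sMP) sPP0 nsXP0) sXM sMP oMX).
  move=> H sXH sHP oH; apply/eqP; have := noH H.
  by rewrite sXH sHP oH oM eqxx /= negbK.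
have cycAM : cyclic (A / M).
  have /cyclicP[a0 defAX] : cyclic (A / X) by apply: cyclicS (quotientS X sAP) cycPX.
  have /morphimP[a nXa Aa def_a0] : a0 \in A / X by rewrite defAX cycle_id.
  apply: (@cyclicS _ (<[a]> / M)); last exact/quotient_cyclic/cycle_cyclic.
  have nXA := subset_trans sAP0 nXP0; have nMA := subset_trans sAP0 nMP0.
  rewrite quotientSK //; apply: subset_trans (mulSg _ sXM).
  by rewrite -quotientSK // quotient_cycle // defAX def_a0.
have [eqBA | [E maxE sBE]] := maximal_exists sBA.
  by rewrite eqBA properxx in ltBA.
have sEA := proper_sub (maxgroupp maxE).
have iAE := p_maximal_index pA maxE.
have sME : M \subset E := subset_trans (joing_subl _ _) sBE.
suffices nsEY : E <| Y.
  have := index_over_cent_neq nsAY sAO (subset_trans sCB sBE) nsEY sEA.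
  by rewrite iAE eqxx.
have nsME : M <| E := normalS sME (subset_trans sEA (normal_sub nsAY)) nsMY.
rewrite -(quotientGK nsME) -(quotientGK nsMY) cosetpre_normal.
apply: char_normal_trans (quotient_normal M nsAY).
by rewrite sub_cyclic_char // quotientS.
Qed.

End ChiefM.

End Reduction.

(** * Induction through quotients by minimal normal subgroups *)

Lemma min_nonpnil_exists (gT : finGroupType) (p : nat) (G P : {group gT}) :
    p.-Sylow(G) P -> ~~ pnil p G -> pnil p 'N_G(P) ->
  exists2 Y : {group gT}, Y \subset G & min_nonpnil p Y P.
Proof.
move=> sylP not_nilG nilN; have sPG := pHall_sub sylP.
pose gY (Y : {group gT}) := [&& P \subset Y, Y \subset G & ~~ pnil p Y].
have [Y] : {Y : {group gT} | mingroup Y gY}.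
  by apply: ex_mingroup; exists G; rewrite /gY sPG subxx.
case/mingroupP=> /and3P[sPY sYG not_nilY] minY.
exists Y => //; split=> //; first exact: pHall_subl sylP.
  by apply: pnilS nilN; rewrite setSI.
move=> X sPX ltXY; apply: contraLR (ltXY) => not_nilX.
have sXY := proper_sub ltXY.
have defX : X :=: Y by apply: minY; rewrite // /gY sPX not_nilX (subset_trans sXY).
by rewrite defX properxx.
Qed.

Lemma minnormal_chief (gT : finGroupType) (G M : {group gT}) :
  minnormal M G -> M \subset G -> chief_factor G 1 M.
Proof.
case/mingroupP=> /andP[ntM nMG] minM sMG.
rewrite /chief_factor /normal sMG nMG !andbT.
apply/maxgroupP; split; first by rewrite norms1 properEneq eq_sym ntM sub1G.
move=> H /andP[ltHM nHG] _; apply/eqP; apply: contraT => ntH.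
have defH : H :=: M by apply: minM (proper_sub ltHM); apply/andP.
by rewrite defH properxx in ltHM.
Qed.

Section QuotientStep.

Variables (gT : finGroupType) (p m k : nat) (G P0 P R M : {group gT}).
Hypothesis (p_pr : prime p).
Hypothesis sylP0 : p.-Sylow(G) P0.
Hypotheses (nsPP0 : P <| P0) (nsMG : M <| G) (sMR : M \subset R).
Hypothesis sPRP : P0 :&: R \subset P.
Hypotheses (oPM : #|P0 :&: M| = (p ^ k)%N) (ltkm : k < m).

Let nMG := normal_norm nsMG.
Let sP0G := pHall_sub sylP0.
Let sPP0 := normal_sub nsPP0.
Let nMP0 := subset_trans sP0G nMG.
Let nMP := subset_trans sPP0 nMP0.

Let PM : P :&: M = P0 :&: M.
Proof.
apply/eqP; rewrite eqEsubset setSI //= subsetI subsetIr andbT.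
by rewrite (subset_trans _ sPRP) // setIS.
Qed.

(** By the Frattini argument the normaliser of P0 in G covers that of P0 / M
    in G / M. *)
Lemma pnil_quotient_norm : pnil p 'N_G(P0) -> pnil p 'N_(G / M)(P0 / M).
Proof.
move=> nilN; have sMMP : M \subset M <*> P0 := joing_subl _ _.
have sMPG : M <*> P0 \subset G by rewrite join_subG normal_sub.
have <- : (M <*> P0) / M = P0 / M by rewrite quotientYidl.
have nsMMP : M <| M <*> P0 := normalS sMMP sMPG nsMG.
rewrite -quotient_subnormG //; set N := 'N_G(_).
have sMPN : M <*> P0 \subset N by rewrite subsetI sMPG normG.
have sNG : N \subset G := subsetIl _ _.
have nsMPN : M <*> P0 <| N by rewrite /normal sMPN subsetIr.
have sylP0' : p.-Sylow(M <*> P0) P0 := pHall_subl (joing_subr _ _) sMPG sylP0.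
have defMP : M <*> P0 = M * P0 by rewrite norm_joinEr.
have sP0NN : P0 \subset 'N_N(P0).
  by rewrite subsetI normG (subset_trans (joing_subr _ _) sMPN).
have defN : M * 'N_N(P0) = N.
  apply: etrans (Frattini_arg nsMPN sylP0').
  by rewrite -[X in _ = X * _]/(M <*> P0) defMP -mulgA (mulSGid sP0NN).
have <- : 'N_N(P0) / M = N / M by rewrite -[in RHS]defN quotientMidl.
apply: pnil_quotient; first by rewrite (subset_trans (subsetIl _ _)) // (subset_trans sNG).
by apply: pnilS nilN; rewrite setSI.
Qed.

Lemma card_quotient_P : (#|P / M| * p ^ k)%N = #|P|.
Proof.
rewrite -oPM -PM -(card_isog (second_isog nMP)) card_quotient; last first.
  by rewrite normsI // normsG // subxx.
by rewrite mulnC setIC Lagrange // subsetIr.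
Qed.

(** A subgroup of P / M is the image of its preimage H in P, which contains
    P :&: M, of order p ^ k; so the order of H is p ^ m. *)
Lemma quotient_hypothesis :
    (forall H : {group gT}, H \subset P -> #|H| = (p ^ m)%N ->
       pnil_supplemented p G H \/ p_embedded p G R H) ->
  forall H : {group coset_of M}, H \subset P / M -> #|H| = (p ^ (m - k))%N ->
    pnil_supplemented p (G / M) H \/ p_embedded p (G / M) (R / M) H.
Proof.
move=> hypH Hb sHbP oHb.
have sMMP : M \subset M <*> P := joing_subl _ _.
have sMPG : M <*> P \subset G by rewrite join_subG normal_sub // (subset_trans sPP0).
have nsMMP : M <| M <*> P := normalS sMMP sMPG nsMG.
have sHbMP : Hb \subset (M <*> P) / M by rewrite quotientYidl.
have [J defHb sMJ sJMP] := inv_quotientS nsMMP sHbMP.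
pose H := (P :&: J)%G.
have defJ : M * H = J.
  by rewrite /= group_modl // -norm_joinEr // (setIidPr sJMP).
have defHb' : Hb :=: H / M by rewrite defHb -defJ quotientMidl.
have sHP : H \subset P := subsetIl _ _.
have oH : #|H| = (p ^ m)%N.
  have HM : M :&: H = P0 :&: M.
    by rewrite -PM /= setICA (setIidPl sMJ).
  have oJ : #|J| = (#|M| * p ^ (m - k))%N.
    by rewrite -oHb defHb card_quotient ?Lagrange // (subset_trans sJMP) ?normal_norm.
  apply/eqP; rewrite -(eqn_pmul2l (cardG_gt0 M)) mul_cardG defJ HM oJ oPM -mulnA.
  by rewrite -expnD subnK // ltnW.
have sHG : H \subset G by rewrite (subset_trans sHP) // (subset_trans sPP0).
have -> : Hb = (H / M)%G by apply: val_inj.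
case: (hypH H sHP oH) => [suppH | embH]; [left | right].
  exact: quotient_supplemented.
exact: quotient_embedded.
Qed.

End QuotientStep.

(** The hypothesis in this form is inherited by the quotients G / M with M
    contained in R, with m lowered by k when P0 :&: M has order p ^ k. *)
Theorem supplemented_or_embedded_pnil (gT : finGroupType) (p m : nat)
    (G P0 P R : {group gT}) :
    prime p -> odd p -> p.-Sylow(G) P0 -> P <| P0 -> R <| G -> p.-group (G / R) ->
    P0 :&: R \subset P -> pnil p 'N_G(P0) -> 0 < m -> p ^ m < #|P| ->
    (forall H : {group gT}, H \subset P -> #|H| = (p ^ m)%N ->
       pnil_supplemented p G H \/ p_embedded p G R H) ->
  pnil p G.
Proof.
move=> p_pr p_odd; have [n] := ubnP #|G|.
elim: n => // n IHn in gT m G P0 P R *; rewrite ltnS => leGn.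
move=> sylP0 nsPP0 nsRG pGR sPRP nilN m_gt0 ltmP hypH; apply: contraT => not_nilG.
have [Y sYG minY] := min_nonpnil_exists sylP0 not_nilG nilN.
have nilYO := min_nonpnil_quotient p_pr p_odd minY.
have [K hallK] := min_Hall_exists nilYO.
have [sylP0Y _ _ _] := minY; have sKY := pHall_sub hallK.
have sP0Y := pHall_sub sylP0Y; have pP0 := pHall_pgroup sylP0.
have not_cOK := min_Hall_not_cent minY nilYO hallK.
have [defS | [Q0 maxQ0 sSQ0]] := maximal_exists (subsetIl P0 'N(K)).
  case/negP: not_cOK; apply/commG1P/trivgP.
  have <- : K :&: 'O_p(Y) = 1.
    apply: coprime_TIg; rewrite coprime_sym.
    exact: pnat_coprime (pcore_pgroup p Y) (pHall_pgroup hallK).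
  rewrite subsetI commg_subl commg_subr.
  rewrite (subset_trans (pcore_sub_Hall sylP0Y)) -?defS ?subsetIr //=.
  exact: subset_trans sKY (normal_norm (pcore_normal _ _)).
have [m1 | m_neq1] := eqVneq m 1%N.
  by case: (embedded_order_p p_pr p_odd sylP0 nsPP0 nsRG pGR sPRP hypH
              sYG minY hallK maxQ0 sSQ0 m1).
have m_gt1 : 1 < m by rewrite ltn_neqAle eq_sym m_neq1.
have ntR : R :!=: 1.
  apply: contraNneq not_cOK => R1.
  have := Hall_sub_residual nsRG pGR sYG hallK.
  by rewrite R1 => /trivgP->; apply: sub1G.
have [M minM sMR] := minnormal_exists ntR (normal_norm nsRG).
have chiefM := minnormal_chief minM (subset_trans sMR (normal_sub nsRG)).
have [_ nsMG] := andP chiefM.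
have ntM : M :!=: 1 by case/mingroupP: minM => /andP[].
have IHM k : #|P0 :&: M| = (p ^ k)%N -> k < m -> pnil p (G / M).
  move=> oPM ltkm; have nMG := normal_norm nsMG.
  have nMP0 := subset_trans (pHall_sub sylP0) nMG.
  apply: (IHn _ (m - k)%N (G / M)%G (P0 / M)%G (P / M)%G (R / M)%G).
  - by apply: leq_trans leGn; apply: ltn_quotient => //; apply: normal_sub.
  - exact: quotient_pHall.
  - exact: quotient_normal.
  - exact: quotient_normal.
  - rewrite /pgroup card_quotient ?quotient_norms ?(normal_norm nsRG) //.
    rewrite index_quotient_eq ?(normal_sub nsRG) //.
      by rewrite -card_quotient // normal_norm.
    by rewrite subIset // sMR orbT.
  - by rewrite -quotientIG // quotientS.
  - exact: pnil_quotient_norm.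
  - by rewrite subn_gt0.
  - rewrite -(ltn_pmul2r (_ : 0 < p ^ k)) ?expn_gt0 ?prime_gt0 //.
    by rewrite (card_quotient_P sylP0 nsPP0 nsMG sMR sPRP oPM) -expnD subnK // ltnW.
  exact: (quotient_hypothesis sylP0 nsPP0 nsMG sMR sPRP oPM).
have not_p'M : ~~ p^'.-group M.
  apply: contra not_nilG => p'M; apply: (pnil_p'quotient nsMG p'M).
  apply: (IHM 0%N) => //; rewrite coprime_TIg ?cards1 //.
  exact: pnat_coprime pP0 p'M.
have sMP0 := minimal_sub_Sylow p_pr p_odd sylP0 nsPP0 sPRP ltmP hypH sYG minY hallK
  maxQ0 sSQ0 chiefM sMR m_gt0 not_p'M.
have leM := card_minimal p_pr p_odd sylP0 nsPP0 sPRP ltmP hypH sYG minY hallK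
  maxQ0 sSQ0 chiefM sMR m_gt0 not_p'M.
have neqM := card_minimal_neq p_pr p_odd sylP0 nsPP0 nsRG pGR sPRP ltmP hypH sYG minY hallK
  maxQ0 sSQ0 chiefM sMR m_gt0 not_p'M m_gt1.
have cardM := card_pgroup (pgroupS sMP0 pP0).
suffices nilGM : pnil p (G / M).
  by case: (minimal_quotient_contra p_pr p_odd sylP0 nsPP0 sPRP ltmP hypH sYG minY hallK
    maxQ0 sSQ0 chiefM sMR m_gt0 not_p'M nilGM).
apply: (IHM (logn p #|M|)); first by rewrite (setIidPr sMP0).
by rewrite -(ltn_exp2l _ _ (prime_gt1 p_pr)) -cardM ltn_neqAle neqM.
Qed.

(** * The p-residual and Pi-normal p-subgroups *)

Lemma subnormal_p'elt (gT : finGroupType) (p : nat) (G T : {group gT}) x :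
  T <|<| G -> p.-nat #|G : T| -> x \in G -> p^'.-elt x -> x \in T.
Proof.
have [n] := ubnP #|G|; elim: n => // n IHn in G *; rewrite ltnS => leGn.
move=> snT pGT Gx p'x; have [-> // | [K [snTK nsKG ltKG]]] := subnormalEr snT.
have [sTK sKG] := (subnormal_sub snTK, normal_sub nsKG).
have := pGT; rewrite -(Lagrange_index sKG sTK) pnatM => /andP[pGK pKT].
apply: (IHn K) => //; first exact: leq_trans (proper_card ltKG) leGn.
rewrite -cycle_subG (p'group_sub_pquo nsKG _ _ p'x) ?cycle_subG //.
by rewrite /pgroup card_quotient ?normal_norm.
Qed.

Definition p'residual (gT : finGroupType) (p : nat) (G : {set gT}) :=
  <<[set x in G | p^'.-elt x]>>%G.

Lemma p'residual_normal (gT : finGroupType) (p : nat) (G : {group gT}) :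
  p'residual p G <| G.
Proof.
rewrite /normal gen_subG norms_gen ?andbT.
  by apply/subsetP=> x; rewrite inE => /andP[].
apply/subsetP=> y Gy; rewrite inE; apply/subsetP=> z.
rewrite mem_conjg !inE => /andP[Gz p'z].
by rewrite -(conjgKV y z) groupJ // p_eltJ.
Qed.

Lemma p'residual_quotient (gT : finGroupType) (p : nat) (G : {group gT}) :
  p.-group (G / p'residual p G).
Proof.
apply/pgroupP=> q q_pr /(Cauchy q_pr)[xb /morphimP[x Nx Gx def_xb] ox].
apply: contraT => p'q; have p'xb : p^'.-elt xb by rewrite /p_elt ox pnatE.
have xb1 : xb = 1.
  rewrite -(constt_p_elt p'xb) def_xb -morph_constt //; apply: coset_id.
  by apply: mem_gen; rewrite inE groupX // p_elt_constt.
by have := prime_gt1 q_pr; rewrite -ox xb1 order1.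
Qed.

(** In the p-nilpotent group G / N the p'-elements generate a p'-group, which
    meets the image of P trivially. *)
Lemma p'residual_sub_Sylow (gT : finGroupType) (p : nat) (G N P : {group gT}) :
    N <| G -> p_nilpotent p (G / N) -> p.-group P -> P \subset G ->
  P :&: p'residual p G \subset N.
Proof.
move=> nsNG /p_nilpotentP nilGN pP sPG; have nNG := normal_norm nsNG.
have sPR : P :&: p'residual p G \subset P := subsetIl _ _.
rewrite -quotient_sub1 ?(subset_trans sPR) ?(subset_trans sPG) //.
have <- : (P / N) :&: 'O_p^'(G / N) = 1.
  apply: coprime_TIg; apply: pnat_coprime (quotient_pgroup N pP) _.
  exact: pcore_pgroup.
rewrite subsetI quotientS //= (subset_trans (quotientS N (subsetIr _ _))) //.
rewrite sub_quotient_pre; last exact: subset_trans (normal_sub (p'residual_normal p G)) nNG.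
rewrite gen_subG; apply/subsetP=> x; rewrite inE => /andP[Gx p'x].
have Nx := subsetP nNG x Gx.
rewrite mem_morphpre // (mem_Hall_pcore nilGN) ?mem_quotient //.
exact: morph_p_elt.
Qed.

(** The index of T divides the order of H, so it is a power of p and T
    contains all the p'-elements of G. The intersection of I / K with L / K is
    a p-group, so the indices in the Pi-property are powers of p. *)
Lemma Pi_normal_embedded (gT : finGroupType) (p : nat) (G H : {group gT}) :
    H \subset G -> p.-group H -> Pi_normal G H ->
  p_embedded p G (p'residual p G) H.
Proof.
move=> sHG pH [T [I [snT defG sHTI sIH PiI]]].
have sTG := subnormal_sub snT.
have pGT : p.-nat #|G : T|.
  apply: (@pnat_dvd _ #|H|); last exact: pH.
  rewrite -(dvdn_pmul2l (cardG_gt0 T)) Lagrange // -[in X in X %| _]defG mulnC.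
  by rewrite mul_cardG dvdn_mulr.
exists I; split=> //.
  apply: subset_trans sHTI; rewrite setIS // gen_subG; apply/subsetP=> x.
  by rewrite inE => /andP[Gx p'x]; apply: (subnormal_p'elt snT pGT Gx p'x).
move=> K L chiefKL; have [maxK nsLG] := andP chiefKL.
have sKL := maxnormal_sub maxK; have sLG := normal_sub nsLG.
have nKG : G \subset 'N(K) by case/maxgroupP: maxK => /andP[].
have sIG := subset_trans sIH sHG.
have sXG : K <*> (I :&: L) \subset G.
  by rewrite join_subG (subset_trans sKL) //= subIset // sIG.
have nsKX : K <| K <*> (I :&: L).
  by rewrite /normal joing_subl (subset_trans sXG).
have defX : (K <*> (I :&: L)) / K = (I / K) :&: (L / K).
  rewrite -quotientIG // quotientYidl // (subset_trans _ nKG) //.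
  by rewrite subIset // sIG.
have := PiI K L chiefKL; rewrite -defX -quotient_subnormG //.
rewrite index_quotient_eq ?subsetIl //; last first.
  by rewrite setIS //; apply: subset_trans (normal_sub nsKX) (normG _).
apply: sub_in_pnat => q _; rewrite defX mem_primes => /and3P[q_pr _].
apply: pgroupP q_pr; apply: pgroupS (subsetIl _ _) _.
exact: quotient_pgroup (pgroupS sIH pH).
Qed.

Theorem theoremA (gT : finGroupType) (G N P : {group gT}) (p : nat)
  (p_pr : prime p) (p_odd : odd p)
  (nsNG : N <| G)
  (GN_nil : p_nilpotent p (G / N))
  (sylP : p.-Sylow(N) P)
  (NP_nil : p_nilpotent p 'N_G(P))
  (hm : exists m : nat,
     (1 < p ^ m)%N /\ (p ^ m < #|P|)%N /\
     forall H : {group gT}, H \subset P -> #|H| = (p ^ m)%N ->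
       ~ has_p_nilpotent_supplement p H G -> Pi_normal G H) :
  p_nilpotent p G.
Proof.
have [m [lt1pm [ltpmP PiH]]] := hm; apply/p_nilpotentP.
have [sNG nNG] := andP nsNG; have [sPN pP _] := and3P sylP.
have [P0 sylP0 sPP0] := Sylow_superset (subset_trans sPN sNG) pP.
have [sP0G pP0 _] := and3P sylP0.
have defP : P :=: P0 :&: N.
  apply/esym; apply: (sub_pHall sylP); rewrite ?subsetIr //.
    by rewrite (pgroupS _ pP0) ?subsetIl.
  by rewrite subsetI sPP0.
have nsPP0 : P <| P0 by rewrite defP (normalGI sP0G).
have sNP : 'N_G(P0) \subset 'N_G(P).
  rewrite defP subsetI subsetIl normsI ?subsetIr //.
  by rewrite (subset_trans (subsetIl _ _)).
apply: (supplemented_or_embedded_pnil p_pr p_odd sylP0 nsPP0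
          (p'residual_normal p G) (p'residual_quotient p G) _ _ _ ltpmP).
- by rewrite defP subsetI subsetIl p'residual_sub_Sylow.
- by apply: pnilS sNP _; apply/p_nilpotentP.
- by case: (m) lt1pm.
move=> H sHP oH; have sHG := subset_trans (subset_trans sHP sPN) sNG.
have [/existsP[T /and3P[sTG /eqP defG nilT]] | not_supp] :=
    boolP [exists T : {group gT}, [&& T \subset G, H * T == G & pnil p T]].
  by left; exists T.
right; apply: Pi_normal_embedded; rewrite ?(pgroupS sHP) //.
apply: PiH => // [[T [[sTG defG] /p_nilpotentP nilT]]].
case/negP: not_supp; apply/existsP; exists T.
by rewrite sTG nilT andbT; apply/eqP.
Qed.
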